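(* There exist universal constants $d, C, D, E>0$ and a function $\mathcal{L}=\mathcal{L}(N,s,\varepsilon,K)$ depending polylogarithmically on $N$ and $s$, such that for every $K\ge 1$ and all constants $D_1,D_2>0$ (independent of $m$ and $N$) there exists a constant $c>0$, depending on $D_1$, $D_2$ and $K$, for which the following holds. Let $N\in\mathbb{N}$, let $\varepsilon\in(0,1)$, let $\Phi=\{\phi_1,\dots,\phi_N\}$ be a bounded orthonormal system with constant $K$, and let the sparsity level $s\in\mathbb{N}$, $s\ge 1$, satisfy $$ s \leq \frac{\varepsilon\,\sqrt{N}}{c\;\mathcal{L}(N,s,\varepsilon,K)\;\ln^{1/2}(N)}. $$ Let $$ m=\lceil d\, s\,\mathcal{L}(N,s,\varepsilon,K)\rceil, $$ let $\mathbf{A}\in\mathbb{C}^{m\times N}$ be the random sampling matrix associated with $\Phi$ with $m$ measurements, and assume that the distortion parameter $\xi$ of $\Phi$ (for $m$ samples) satisfies $$ \xi \leq \min\left\{D_1\sqrt{\frac{m^2\ln(m)}{N}},\; D_2\right\}. $$ Then, with probability at least $1-\varepsilon$, the following holds: for every $\mathbf{x}\in\mathbb{C}^N$, $\mathbf{n}\in\mathbb{C}^m$ and $\eta\ge 0$, with $\mathbf{y}=\mathbf{A}\mathbf{x}+\mathbf{n}$, every minimizer $$\widehat{\mathbf{x}}(\eta)\in\arg\min_{\mathbf{z}\in\mathbb{C}^N}\|\mathbf{z}\|_1\quad\text{subject to}\quad \|\mathbf{A}\mathbf{z}-\mathbf{y}\|_2\le\eta$$ satisfies $$ \|\widehat{\mathbf{x}}(\eta)-\mathbf{x}\|_2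 \leq \frac{C}{\sqrt{s}}\,\sigma_s(\mathbf{x})_1 + D\,\eta + E\,\mathcal{L}(N,s,\varepsilon,K)^{1/2}\,\max\{\|\mathbf{n}\|_2-\eta,\,0\}. $$ Moreover, the function $\mathcal{L}$ can be defined as $$\mathcal{L}(N,s,\varepsilon,K)=\frac{K^2}{\delta^2}\max\left\{\ln^2(s)\,\ln\!\left(\frac{K^2}{\delta^2}\, s\ln(N)\right)\ln(N),\;\ln\!\left(\frac{1}{\varepsilon}\right)\right\}\quad\text{with } \delta=\tfrac12.$$
   Context: Bounded orthonormal system (BOS): let $\mathcal{D}\subseteq\mathbb{R}^p$ be endowed with a probability measure $\nu$. A set $\Phi=\{\phi_1,\dots,\phi_N\}$ of complex-valued functions on $\mathcal{D}$ is a bounded orthonormal system with constant $K$ if for all $j,k\in\{1,\dots,N\}$ one has $\int_{\mathcal{D}}\phi_j(\tau)\overline{\phi_k(\tau)}\,d\nu(\tau)=\delta_{jk}$ (Kronecker delta) and $\|\phi_j\|_\infty:=\sup_{\tau\in\mathcal{D}}|\phi_j(\tau)|\le K$. Random sampling matrix: given independent random variables $\tau_1,\dots,\tau_m$ distributed according to $\nu$, the random sampling matrix $\mathbf{A}\in\mathbb{C}^{m\times N}$ associated with $\Phi$ has entries $A_{kj}=m^{-1/2}\phi_j(\tau_k)$ for $k\in\{1,\dots,m\}$, $j\in\{1,\dots,N\}$. Distortion parameter: for a random matrix $\mathbf{M}=[\mathbf{m}_1|\cdots|\mathbf{m}_m]\in\mathbb{C}^{N\times m}$, the distortion parameter is $\xi:=\mathbb{E}\max_{k\in\{1,\dots,m\}}\left|\frac{\|\mathbf{m}_k\|_2^2}{N}-1\right|$.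 The distortion parameter of the BOS $\Phi$ (for $m$ samples) is that of $\mathbf{M}=\sqrt{m}\,\mathbf{A}^*$, that is, $\xi=\mathbb{E}\max_{k\in\{1,\dots,m\}}\left|\frac1N\sum_{j=1}^N|\phi_j(\tau_k)|^2-1\right|$. Best $s$-term approximation error with respect to the $\ell^1$-norm: $\sigma_s(\mathbf{x})_1:=\min\{\|\mathbf{x}-\mathbf{z}\|_1:\ \mathbf{z}\in\mathbb{C}^N \text{ has at most } s \text{ nonzero entries}\}$. ''Polylogarithmically in $N$ and $s$'' refers to growth, for fixed $\varepsilon$ and $K$, at most polynomial in the logarithms of $N$ and $s$. The optimization program in the claim is called quadratically constrained basis pursuit (QCBP).
   Formalization: The explicit formula for L is asserted only for s ≥ 2, since at s = 1 it gives a number of samples independent of N and the claim then fails (e.g. for the Fourier system); the recovery bound itself is still proved for s = 1 with a different value of L. *)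

(* Defs.v *)
(* MathComp / MathComp-Analysis *)
From HB Require Import structures.
From mathcomp Require Export all_boot all_order all_algebra spectral.
From mathcomp Require Export complex.
From mathcomp Require Export all_classical all_reals all_analysis.

Set Implicit Arguments.
Unset Strict Implicit.
Unset Printing Implicit Defensive.

Export Order.TTheory GRing.Theory Num.Theory.
Export numFieldNormedType.Exports.

Open Scope classical_set_scope.
Open Scope ring_scope.
Open Scope sesquilinear_scope.

Section Vectors.
Context {R : realType}.
Implicit Types (m N : nat).

(* [Normc.normc] is the complex modulus with values in [R]; the generic [`|z|]
   of [R[i]] takes its values in [R[i]]. *)
Definition modulus (z : R[i]) : R := ComplexField.Normc.normc z.

Definition l1norm N (x : 'cV[R[i]]_N) : R := \sum_(i < N) modulus (x i 0).

Definition l2norm N (x : 'cV[R[i]]_N) : R :=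
  Num.sqrt (\sum_(i < N) modulus (x i 0) ^+ 2).

Definition sparse N (s : nat) (z : 'cV[R[i]]_N) : Prop :=
  (#|[pred i : 'I_N | (z i 0 != 0)%R]| <= s)%N.

(* The infimum is attained: the sparse vectors form a nonempty closed set. *)
Definition best_approx_l1 N (s : nat) (x : 'cV[R[i]]_N) : R :=
  inf [set l1norm (x - z) | z in [set z | sparse s z]].

Definition qcbp_feasible m N (A : 'M[R[i]]_(m, N)) (y : 'cV[R[i]]_m) (eta : R)
    (z : 'cV[R[i]]_N) : Prop :=
  l2norm (A *m z - y) <= eta.

Definition qcbp_minimizer m N (A : 'M[R[i]]_(m, N)) (y : 'cV[R[i]]_m) (eta : R)
    (xhat : 'cV[R[i]]_N) : Prop :=
  qcbp_feasible A y eta xhat /\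
  forall z, qcbp_feasible A y eta z -> l1norm xhat <= l1norm z.

End Vectors.

Section BoundedOrthonormalSystem.
Context {R : realType} {d : measure_display} {T : measurableType d}.

Definition cmeasurable (f : T -> R[i]) : Prop :=
  measurable_fun [set: T] (fun t => complex.Re (f t)) /\
  measurable_fun [set: T] (fun t => complex.Im (f t)).

Definition cintegral (nu : probability T R) (f : T -> R[i]) : R[i] :=
  Complex (\int[nu]_(t in [set: T]) complex.Re (f t))
          (\int[nu]_(t in [set: T]) complex.Im (f t)).

Definition supnorm (f : T -> R[i]) : \bar R :=
  ereal_sup [set (modulus (f t))%:E | t in [set: T]].

Definition bounded_orthonormal_system (nu : probability T R) (N : nat)
    (phi : 'I_N -> T -> R[i]) (K : R) : Prop :=
  [/\ forall j, cmeasurable (phi j),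
      forall j k, cintegral nu (fun t => phi j t * (phi k t)^*) = (j == k)%:R
    & forall j, (supnorm (phi j) <= K%:E)%E].

Definition sampling_matrix (m N : nat) (phi : 'I_N -> T -> R[i])
    (t : 'I_m -> T) : 'M[R[i]]_(m, N) :=
  \matrix_(k < m, j < N) (((Num.sqrt m%:R)^-1)%:C%C * phi j (t k)).

End BoundedOrthonormalSystem.

Section RandomSamples.
Context {R : realType} {d d' : measure_display}.
Context {Omega : measurableType d} {T : measurableType d'}.

Definition mutually_independent (P : probability Omega R) (m : nat)
    (tau : 'I_m -> {RV P >-> T}) : Prop :=
  forall (J : {set 'I_m}) (B : 'I_m -> set T),
    (forall k, measurable (B k)) ->
    (P (\bigcap_(k in [set k | k \in J]) (tau k @^-1` B k)) =
     \prod_(k in J) P (tau k @^-1` B k))%E.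

Definition iid_samples (P : probability Omega R) (nu : probability T R)
    (m : nat) (tau : 'I_m -> {RV P >-> T}) : Prop :=
  mutually_independent tau /\
  forall k (B : set T), measurable B -> distribution P (tau k) B = nu B.

Definition distortion (P : probability Omega R) (N m : nat)
    (M : Omega -> 'M[R[i]]_(N, m)) : \bar R :=
  ('E_P[(fun w => \big[Num.max/0]_(k < m)
     `| l2norm (col k (M w)) ^+ 2 / N%:R - 1 |)%R])%E.

Definition bos_distortion (P : probability Omega R) (N m : nat)
    (phi : 'I_N -> T -> R[i]) (tau : 'I_m -> {RV P >-> T}) : \bar R :=
  distortion P (fun w =>
    (Num.sqrt m%:R)%:C%C *: (sampling_matrix phi (fun k => tau k w))^t*).

End RandomSamples.

Section LogFactor.
Context {R : realType}.

(* [ln N] and [ln s] are nonnegative, so a bound by a polynomial in the two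
   logarithms is the same as a bound by a constant times a power of
   [1 + ln N + ln s]. *)
Definition polylogarithmic (L : nat -> nat -> R -> R -> R) : Prop :=
  forall eps K : R, 0 < eps < 1 -> 1 <= K ->
  exists (c : R) (a : nat), forall N s : nat, (0 < N)%N -> (0 < s)%N ->
    `| L N s eps K | <= c * (1 + ln N%:R + ln s%:R) ^+ a.

(* For [s = 1] this is [4 * K^2 * ln (1 / eps)], because of the factor
   [ln s ^+ 2]: it does not depend on [N], and that many samples cannot give
   stable recovery of 1-sparse vectors as [N] grows. *)
Definition log_factor (N s : nat) (eps K : R) : R :=
  let delta : R := 2^-1 in
  K ^+ 2 / delta ^+ 2 *
  Num.max (ln s%:R ^+ 2 * ln (K ^+ 2 / delta ^+ 2 * s%:R * ln N%:R) * ln N%:R)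
          (ln (1 / eps)).

End LogFactor.

(* Main.v *)
From HB Require Import structures.
Require Import Defs.
From mathcomp Require Import ring lra measurable_realfun.

(** Three facts about the random matrix A give the theorem: a lower bound for A
on vectors with small l1 norm, a lower bound for its adjoint, and a
deterministic argument that turns these two bounds into the error estimate.

Recovery. Let h be the error of a minimizer and let sigma be the l1 distance
from x to an s-sparse vector. Minimality alone gives
|h|_1 <= 2 sqrt s |h|_2 + 2 sigma. Either the second term dominates, and
|h|_2 <= sigma / sqrt s; or |h|_1 <= 4 sqrt s |h|_2, and a bound
|A v|_2 >= |v|_2 / 16 on the cone |v|_1 <= 4 sqrt s |v|_2 gives
|h|_2 <= 32 eta ([qcbp_recovery], [qcbp_robust]).

Lower bound on the cone. The squared norm |A v|_2 ^ 2 is the empirical mean of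
|f|^2 for f = sum_j v_j phi_j. Orthonormality makes the true mean of |f|^2 equal
to |v|_2 ^ 2, while the real and imaginary parts of f / |v|_2 lie in 8 sqrt s
times the symmetric convex hull of the functions Re phi_j, Im phi_j, so the claim
is a one-sided uniform law of large numbers for a convex hull. Let f now be a
member of this rescaled hull, so that |f| <= B = 8 sqrt s K, and cut the range of
|f| into dyadic levels t. At level t, drawing q ~ (B/t)^2 log B atoms at random
(Maurey's argument) replaces f by an average of q atoms, up to an error t/2 off a
set that is small both for nu and for the empirical measure ([maurey]). There are at most (4N)^q averages, and the lower Chernoff bound
allows an additive loss delta at the price exp (- m delta). A loss proportional
to 1 / t^2 at level t is affordable, so the factors t^2 cancel in the union bound
and m ~ B^2 log^2 B log N samples suffice ([convex_hull_comparison],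
[symmetric_hull_lower_bound], [cone_likely]).

Noise larger than eta. When |n|_2 > eta, the excess (1 - eta / |n|_2) n is
written as A v, and x + v is recovered instead of x with noise of norm eta. A
small v exists as soon as A^* is bounded below by about sqrt (N / m)
([solvable_of_adjoint_lower_bound]), that is, as soon as the Gram matrix of the
columns of sqrt m A^* is close to N times the identity. Its diagonal is
controlled by the distortion parameter through Markov's inequality, and each
off-diagonal entry has second moment exactly N; since m^2 / N is below a small
multiple of eps^2, Markov's inequality also controls the Frobenius norm of the
off-diagonal part ([gram_lower_bound], [diagonal_likely],
[offdiagonal_likely]).

Parameters. The sparsity condition forces 1 / eps <= sqrt N, hence
log (1 / eps) is at most log N. It also forces N to exceed c / 4, where c may
depend on K: choosing c doubly exponential in log^2 K makes the iterated
logarithm of N larger than log^2 K, which absorbs the discrepancy between the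
log^2 (K^2 s) of the covering argument and the log^2 s of the logarithmic factor
([net_size_bound], [sparsity_regime]). For s = 1 the factor L is taken to be its
value at s = 2. *)

Set Implicit Arguments.
Unset Strict Implicit.
Unset Printing Implicit Defensive.

(** * A Hoeffding inequality for finite mixtures *)

Section Elementary.
Context {R : realType}.

Lemma expR_le_quadratic (x : R) : x <= 2^-1 -> expR x <= 1 + x + 2 * x ^+ 2.
Proof.
move=> hx.
have h1 : 1 - x <= expR (- x) by have := expR_ge1Dx (- x).
have h2 : 0 < 1 - x by lra.
have h3 : expR x <= (1 - x)^-1.
  by rewrite -[x in expR x]opprK expRN lef_pV2 // posrE // expR_gt0.
apply: (le_trans h3); rewrite -[leLHS]div1r ler_pdivrMr //.
have : 0 <= x ^+ 2 * (1 - 2 * x) by rewrite mulr_ge0 ?sqr_ge0 //; lra.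
nra.
Qed.

(** In the quadratic bound for exp the linear term averages to zero, and the
deviations are at most 2B, which leaves 1 + 8 (lam B)^2. *)
Lemma mgf_bound (I : finType) (p y : I -> R) (B lam : R) :
  (forall a, 0 <= p a) -> \sum_a p a = 1 -> (forall a, `|y a| <= B) ->
  0 <= lam -> lam * (2 * B) <= 2^-1 ->
  \sum_a p a * expR (lam * (y a - \sum_b p b * y b)) <=
    expR (8 * (lam * B) ^+ 2).
Proof.
move=> p0 p1 yB lam0 lamB.
set mu := \sum_b p b * y b.
have muB : `|mu| <= B.
  apply: (le_trans (ler_norm_sum _ _ _)).
  apply: (@le_trans _ _ (\sum_a p a * B)).
    apply: ler_sum => a _; rewrite normrM (ger0_norm (p0 a)).
    by apply: ler_wpM2l.
  by rewrite -mulr_suml p1 mul1r.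
have bnd a : `|lam * (y a - mu)| <= lam * (2 * B).
  rewrite normrM (ger0_norm lam0) ler_wpM2l //.
  apply: (le_trans (ler_normB _ _)).
  by have := yB a; have := muB; lra.
have step a : p a * expR (lam * (y a - mu)) <=
    p a * (1 + 8 * (lam * B) ^+ 2) + lam * (p a * y a - p a * mu).
  have h : expR (lam * (y a - mu)) <=
      1 + lam * (y a - mu) + 8 * (lam * B) ^+ 2.
    have := @expR_le_quadratic (lam * (y a - mu)).
    have := bnd a; rewrite ler_norml => /andP[b1 b2].
    move=> /(_ (le_trans b2 lamB)) h; apply: (le_trans h).
    rewrite lerD2l.
    have : (lam * (y a - mu)) ^+ 2 <= (lam * (2 * B)) ^+ 2.
      by rewrite -real_normK ?num_real // lerXn2r ?nnegrE // (le_trans _ (bnd a)).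
    nra.
  have := ler_wpM2l (p0 a) h; nra.
apply: (le_trans (ler_sum _ (fun a _ => step a))).
rewrite big_split /= -mulr_suml p1 mul1r -mulr_sumr sumrB -/mu -mulr_suml p1.
by rewrite mul1r subrr mulr0 addr0 expR_ge1Dx.
Qed.

(** Chernoff's method: the mean of a product of exponentials over independent
draws is the product of the means, by distributivity of products over sums. *)
Lemma hoeffding_one_sided (I : finType) (p y : I -> R) (B u : R) (q : nat) :
  (forall a, 0 <= p a) -> \sum_a p a = 1 -> (forall a, `|y a| <= B) ->
  0 < B -> 0 <= u -> u <= 4 * B ->
  \sum_(f : {ffun 'I_q -> I}) (\prod_i p (f i)) *
     (q%:R * u <= \sum_i (y (f i) - \sum_b p b * y b))%R%:R <=
    expR (- (q%:R * u ^+ 2 / (32 * B ^+ 2))).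
Proof.
move=> p0 p1 yB B0 u0 uB.
set mu := \sum_b p b * y b.
(* the minimizer of 8 (lam B)^2 - lam u *)
pose lam := u / (16 * B ^+ 2).
have B2 : 0 < 16 * B ^+ 2 by rewrite mulr_gt0 // exprn_gt0.
have lam0 : 0 <= lam by rewrite divr_ge0 // ltW.
have lamB : lam * (2 * B) <= 2^-1.
  rewrite /lam mulrAC ler_pdivrMr //.
  have := ler_wpM2r (ltW B0) uB; nra.
have step (f : {ffun 'I_q -> I}) : (\prod_i p (f i)) *
     (q%:R * u <= \sum_i (y (f i) - mu))%R%:R <=
   expR (- (lam * (q%:R * u))) * \prod_i (p (f i) * expR (lam * (y (f i) - mu))).
  rewrite [X in _ <= _ * X]big_split /= [leRHS]mulrCA ler_wpM2l ?prodr_ge0 //.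
  rewrite -expR_sum -expRD -mulr_sumr.
  case: (leP (q%:R * u)) => h /=; last exact: expR_ge0.
  have h0 : 0 <= - (lam * (q%:R * u)) + lam * (\sum_i (y (f i) - mu)).
    by rewrite addrC subr_ge0 ler_wpM2l.
  by rewrite (le_trans _ (expR_ge1Dx _)) // lerDl.
apply: (le_trans (ler_sum _ (fun f _ => step f))).
rewrite -mulr_sumr -(bigA_distr_bigA (fun _ a => p a * expR (lam * (y a - mu)))).
rewrite /= prodr_const card_ord.
apply: (@le_trans _ _ (expR (- (lam * (q%:R * u))) * expR (8 * (lam * B) ^+ 2) ^+ q)).
  rewrite ler_wpM2l ?expR_ge0 // lerXn2r ?nnegrE ?expR_ge0 //.
    by apply: sumr_ge0 => a _; rewrite mulr_ge0 ?expR_ge0.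
  exact: mgf_bound.
rewrite -expRM_natr -expRD ler_expR /lam le_eqVlt; apply/orP; left; apply/eqP.
by field; rewrite gt_eqF.
Qed.

Lemma hoeffding (I : finType) (p y : I -> R) (B u : R) (q : nat) :
  (forall a, 0 <= p a) -> \sum_a p a = 1 -> (forall a, `|y a| <= B) ->
  0 < B -> 0 < u -> u <= 4 * B -> (0 < q)%N ->
  \sum_(f : {ffun 'I_q -> I}) (\prod_i p (f i)) *
     (u <= `|\sum_b p b * y b - q%:R^-1 * \sum_i y (f i)|)%R%:R <=
    2 * expR (- (q%:R * u ^+ 2 / (32 * B ^+ 2))).
Proof.
move=> p0 p1 yB B0 u0 uB q0.
have h1 := hoeffding_one_sided q p0 p1 yB B0 (ltW u0) uB.
have yB' a : `|- y a| <= B by rewrite normrN.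
have h2 := hoeffding_one_sided q p0 p1 yB' B0 (ltW u0) uB.
rewrite mulr2n mulrDl mul1r; apply: (le_trans _ (lerD h1 h2)).
rewrite -big_split /=; apply: ler_sum => f _.
rewrite -mulrDr ler_wpM2l ?prodr_ge0 //.
have -> : \sum_b p b * - y b = - \sum_b p b * y b.
  by rewrite -sumrN; apply: eq_bigr => b _; rewrite mulrN.
set mu := \sum_b p b * y b.
have -> : \sum_i (- y (f i) - - mu) = - \sum_i (y (f i) - mu).
  by rewrite -[RHS]sumrN; apply: eq_bigr => i _; rewrite opprB opprK addrC.
have -> : mu - q%:R^-1 * \sum_i y (f i) = - (q%:R^-1 * \sum_i (y (f i) - mu)).
  rewrite sumrB sumr_const card_ord -mulr_natl.
  by field; rewrite pnatr_eq0 -lt0n.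
set S := \sum_i (y (f i) - mu).
have q0' : 0 < q%:R :> R by rewrite ltr0n.
case: (leP u _) => [|_]; last by rewrite /= addr_ge0 ?ler0n.
rewrite normrN normrM gtr0_norm ?invr_gt0 // mulrC ler_pdivlMr // mulrC => h.
case: (lerP 0 S) => S0.
  by rewrite ger0_norm // in h; rewrite h /= lerDl ler0n.
by rewrite ltr0_norm // in h; rewrite h /= lerDr ler0n.
Qed.

End Elementary.

(** * Dyadic levels and Maurey sampling *)

Section Levels.
Context {R : realType}.

Definition level (t0 : R) (i : nat) : R := 2 ^+ i * t0.

Lemma level_ge0 t0 i : 0 < t0 -> 0 <= level t0 i.
Proof. by move=> h; rewrite mulr_ge0 ?exprn_ge0 // ltW. Qed.

Lemma levelS t0 i : level t0 i.+1 = 2 * level t0 i.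
Proof. by rewrite /level exprS mulrA. Qed.

Lemma sum_level_sq (t0 : R) n : 0 < t0 ->
  \sum_(i < n) level t0 i ^+ 2 <= 3^-1 * level t0 n ^+ 2.
Proof.
move=> t00; elim: n => [|n ih].
  by rewrite big_ord0 mulr_ge0 ?sqr_ge0 // invr_ge0.
by rewrite big_ord_recr /= levelS; move: ih; lra.
Qed.

(** The levels below |x| form a geometric progression, so their squares add up
to at most 4/3 of the last one. Conversely, in [sq_le_level_sum], the largest
level with 2t <= |x|, when there is one, already carries a sixteenth of x^2. *)
Lemma level_sum_le_sq (t0 x : R) n : 0 < t0 ->
  \sum_(i < n) level t0 i ^+ 2 * (level t0 i <= `|x|)%R%:R <= 4 / 3 * x ^+ 2.
Proof.
move=> t00; elim: n => [|n ih].
  by rewrite big_ord0 mulr_ge0 ?sqr_ge0.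
rewrite big_ord_recr /=; case: (leP (level t0 n)) => h /=; last first.
  by rewrite mulr0 addr0.
rewrite mulr1.
have h1 : \sum_(i < n) level t0 i ^+ 2 * (level t0 i <= `|x|)%R%:R <=
    3^-1 * level t0 n ^+ 2.
  apply: (le_trans _ (sum_level_sq n t00)); apply: ler_sum => i _.
  by case: (leP (level t0 i)) => _ /=; rewrite ?mulr1 // mulr0 sqr_ge0.
have h2 : level t0 n ^+ 2 <= x ^+ 2.
  by rewrite -(real_normK (num_real x)) lerXn2r ?nnegrE ?level_ge0.
lra.
Qed.

Lemma sq_le_level_sum (t0 x : R) n : 0 < t0 -> `|x| <= 2 * level t0 n ->
  x ^+ 2 <= 4 * t0 ^+ 2 +
    16 * \sum_(i < n) level t0 i ^+ 2 * (2 * level t0 i <= `|x|)%R%:R.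
Proof.
move=> t00; elim: n => [|n ih] hx.
  rewrite big_ord0 mulr0 addr0 -(real_normK (num_real x)).
  rewrite /level expr0 mul1r in hx.
  have := normr_ge0 x; nra.
rewrite big_ord_recr /=; case: (leP (2 * level t0 n)) => h /=; last first.
  by rewrite mulr0 addr0; apply: ih; exact: ltW.
rewrite mulr1.
have h1 : 0 <= \sum_(i < n) level t0 i ^+ 2 * (2 * level t0 i <= `|x|)%R%:R.
  by apply: sumr_ge0 => i _; rewrite mulr_ge0 ?sqr_ge0.
have h2 : x ^+ 2 <= 16 * level t0 n ^+ 2.
  rewrite levelS in hx; rewrite -(real_normK (num_real x)).
  have := normr_ge0 x; nra.
have := sqr_ge0 t0; lra.
Qed.

End Levels.

Section BoundedMeasurable.
Context {R : realType} {d : measure_display} {T : measurableType d}.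
Implicit Types f g : T -> R.

Definition bounded_measurable f : Prop :=
  measurable_fun [set: T] f /\ exists M : R, forall x, `|f x| <= M.

Lemma bounded_measurable_cst (c : R) : bounded_measurable (fun=> c).
Proof. by split; [exact: measurable_cst | exists `|c|]. Qed.

Lemma bounded_measurableD f g : bounded_measurable f -> bounded_measurable g ->
  bounded_measurable (fun x => f x + g x).
Proof.
move=> [mf [M hM]] [mg [M' hM']]; split; first exact: measurable_funD.
by exists (M + M') => x; rewrite (le_trans (ler_normD _ _)) // lerD.
Qed.

Lemma bounded_measurableM f g : bounded_measurable f -> bounded_measurable g ->
  bounded_measurable (fun x => f x * g x).
Proof.
move=> [mf [M hM]] [mg [M' hM']]; split; first exact: measurable_funM.
by exists (M * M') => x; rewrite normrM ler_pM.
Qed.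

Lemma bounded_measurableZ (c : R) f : bounded_measurable f ->
  bounded_measurable (fun x => c * f x).
Proof. by apply: bounded_measurableM; exact: bounded_measurable_cst. Qed.

Lemma bounded_measurableN f : bounded_measurable f ->
  bounded_measurable (fun x => - f x).
Proof.
move=> /(bounded_measurableZ (-1)).
by under [X in bounded_measurable X]funext do rewrite mulN1r.
Qed.

Lemma bounded_measurableB f g : bounded_measurable f -> bounded_measurable g ->
  bounded_measurable (fun x => f x - g x).
Proof. by move=> hf /bounded_measurableN; exact: bounded_measurableD. Qed.

Lemma bounded_measurable_sum (I : Type) (r : seq I) (f : I -> T -> R) :
  (forall i, bounded_measurable (f i)) ->
  bounded_measurable (fun x => \sum_(i <- r) f i x).
Proof.
move=> hf; elim: r => [|i r ih].
  by under [X in bounded_measurable X]funext do rewrite big_nil;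
    exact: bounded_measurable_cst.
by under [X in bounded_measurable X]funext do rewrite big_cons;
  exact: bounded_measurableD.
Qed.

Lemma measurable_superlevel (c : R) f : measurable_fun [set: T] f ->
  measurable [set x | (c <= `|f x|)%R].
Proof.
move=> mf; rewrite -[X in measurable X]setTI.
have mg : measurable_fun [set: T] (fun x => `|f x|).
  by apply: measurableT_comp => //; exact: normr_measurable.
have -> : [set x | (c <= `|f x|)%R] = (fun x => `|f x|) @^-1` `[c, +oo[.
  by apply/seteqP; split=> x /=; rewrite in_itv /= andbT.
exact: mg.
Qed.

Lemma bounded_measurable_superlevel (c : R) f : measurable_fun [set: T] f ->
  bounded_measurable (fun x => (c <= `|f x|)%R%:R).
Proof.
move=> mf; split; last by exists 1 => x; case: (c <= _)%R; rewrite ?normr0 ?normr1.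
have -> : (fun x => (c <= `|f x|)%R%:R) = \1_[set x | (c <= `|f x|)%R] :> (T -> R).
  by apply/funext => x; rewrite indicE mem_setE.
exact/measurable_indic/measurable_superlevel.
Qed.

(** Integration against nu and averaging over the sample points are both of this
form, which lets one argument treat the two measures, and their sum, alike. *)
Definition positive_linear (E : (T -> R) -> R) : Prop :=
  [/\ forall f g, bounded_measurable f -> bounded_measurable g ->
        E (fun x => f x + g x) = E f + E g,
      forall (c : R) f, bounded_measurable f -> E (fun x => c * f x) = c * E f
    & forall f g, bounded_measurable f -> bounded_measurable g ->
        (forall x, f x <= g x) -> E f <= E g].

Section PositiveLinear.
Variable E : (T -> R) -> R.
Hypothesis hE : positive_linear E.

Lemma positive_linear0 : E (fun=> 0) = 0.
Proof.
case: hE => _ Z _; rewrite -[RHS](mul0r (E (fun=> 0))) -Z.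
  by congr E; apply/funext => x; rewrite mul0r.
exact: bounded_measurable_cst.
Qed.

Lemma positive_linear_ge0 f : bounded_measurable f -> (forall x, 0 <= f x) ->
  0 <= E f.
Proof.
case: hE => _ _ M hf f0; rewrite -positive_linear0; apply: M => //.
exact: bounded_measurable_cst.
Qed.

Lemma positive_linear_sum (I : Type) (r : seq I) (f : I -> T -> R) :
  (forall i, bounded_measurable (f i)) ->
  E (fun x => \sum_(i <- r) f i x) = \sum_(i <- r) E (f i).
Proof.
move=> hf; elim: r => [|i r ih].
  rewrite big_nil -[RHS]positive_linear0; congr E.
  by apply/funext => x; rewrite big_nil.
rewrite big_cons -ih; case: hE => D _ _; rewrite -D //; last first.
  exact: bounded_measurable_sum.
by congr E; apply/funext => x; rewrite big_cons.
Qed.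

Lemma positive_linear_sumZ (I : Type) (r : seq I) (c : I -> R) (f : I -> T -> R) :
  (forall i, bounded_measurable (f i)) ->
  E (fun x => \sum_(i <- r) c i * f i x) = \sum_(i <- r) c i * E (f i).
Proof.
move=> hf; rewrite positive_linear_sum => [|i]; last exact: bounded_measurableZ.
by apply: eq_bigr => i _; case: hE => _ -> .
Qed.

End PositiveLinear.

Lemma positive_linearD (E1 E2 : (T -> R) -> R) :
  positive_linear E1 -> positive_linear E2 ->
  positive_linear (fun f => E1 f + E2 f).
Proof.
move=> [D1 Z1 M1] [D2 Z2 M2]; split=> [f g hf hg|c f hf|f g hf hg fg].
- by rewrite D1 // D2 //; ring.
- by rewrite Z1 // Z2 //; ring.
- by rewrite lerD ?M1 ?M2.
Qed.

End BoundedMeasurable.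

Section ConvexHull.
Context {R : realType} {d : measure_display} {T : measurableType d}.
Variables (I : finType) (F : I -> T -> R) (B : R).
Hypothesis (bmF : forall a, bounded_measurable (F a)).
Hypothesis (FB : forall a x, `|F a x| <= B).
Hypothesis (B0 : 0 < B).

Definition combination (p : I -> R) (x : T) : R := \sum_a p a * F a x.

Definition average q (f : {ffun 'I_q -> I}) (x : T) : R :=
  q%:R^-1 * \sum_i F (f i) x.

Lemma bounded_measurable_combination p : bounded_measurable (combination p).
Proof. by apply: bounded_measurable_sum => a; exact: bounded_measurableZ. Qed.

Lemma bounded_measurable_average q (f : {ffun 'I_q -> I}) :
  bounded_measurable (average f).
Proof. by apply: bounded_measurableZ; exact: bounded_measurable_sum. Qed.

Lemma combination_le p x :
  (forall a, 0 <= p a) -> \sum_a p a = 1 -> `|combination p x| <= B.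
Proof.
move=> p0 p1; apply: (le_trans (ler_norm_sum _ _ _)).
rewrite -[leRHS]mul1r -p1 mulr_suml; apply: ler_sum => a _.
by rewrite normrM (ger0_norm (p0 a)) ler_wpM2l.
Qed.

(** Maurey's empirical method. At every point the average of [q] random atoms
misses the combination by [u] with the exponentially small probability of
Hoeffding's inequality; integrating against [E] and exchanging the two means
produces one tuple whose exceptional set is small for [E]. Taking for [E] a sum
of two means makes the same tuple good for both. *)
Lemma maurey (E : (T -> R) -> R) (p : I -> R) (u : R) (q : nat) :
  positive_linear E ->
  (forall a, 0 <= p a) -> \sum_a p a = 1 ->
  0 < u -> u <= 4 * B -> (0 < q)%N ->
  exists f : {ffun 'I_q -> I},
    E (fun x => (u <= `|combination p x - average f x|)%R%:R) <=
    2 * expR (- (q%:R * u ^+ 2 / (32 * B ^+ 2))) * E (fun=> 1).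
Proof.
move=> hE p0 p1 u0 uB q0.
set c := 2 * _; pose w (f : {ffun 'I_q -> I}) := \prod_i p (f i).
pose bad (f : {ffun 'I_q -> I}) x : R :=
  (u <= `|combination p x - average f x|)%R%:R.
have w0 f : 0 <= w f by exact: prodr_ge0.
have w1 : \sum_f w f = 1.
  by rewrite -(bigA_distr_bigA (fun _ a => p a)) /= p1 big1.
have bmbad f : bounded_measurable (bad f).
  apply: bounded_measurable_superlevel.
  apply: (bounded_measurableB _ _).1.
    exact: bounded_measurable_combination.
  exact: bounded_measurable_average.
have h : \sum_f w f * E (bad f) <= c * E (fun=> 1).
  rewrite -positive_linear_sumZ //; case: (hE) => _ Z M.
  rewrite -Z; last exact: bounded_measurable_cst.
  apply: M => [||x]; rewrite ?mulr1.
  - by apply: bounded_measurable_sum => f; exact: bounded_measurableZ.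
  - by apply: bounded_measurableZ; exact: bounded_measurable_cst.
  - exact: hoeffding.
apply: contrapT => /forallNP hN.
have lt_bad f : c * E (fun=> 1) < E (bad f).
  by rewrite ltNge; apply/negP; exact: hN.
have s0 : \sum_f w f * (E (bad f) - c * E (fun=> 1)) = 0.
  apply/eqP; rewrite eq_le sumr_ge0 ?andbT => [|f _]; last first.
    by rewrite mulr_ge0 // subr_ge0 ltW.
  under eq_bigr do rewrite mulrBr.
  by rewrite sumrB -mulr_suml w1 mul1r subr_le0.
have wz f : w f = 0.
  have /psumr_eq0P : \sum_f w f * (E (bad f) - c * E (fun=> 1)) = 0 by [].
  move=> /(_ (fun f _ => mulr_ge0 (w0 f) _)) h0.
  have /eqP := h0 (fun f => ltW (etrans (subr_gt0 _ _) (lt_bad f))) f isT.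
  by rewrite mulf_eq0 subr_eq0 (gt_eqF (lt_bad f)) orbF => /eqP.
have := w1; rewrite big1 // => /eqP.
by rewrite eq_sym oner_eq0.
Qed.

(** The true mean of the square of a combination is compared with its empirical
mean through indicators, level by level. With G the Maurey average at level t,
|F| >= 2t forces |G| >= 3t/2 outside the exceptional set, and |G| >= 3t/2 forces
|F| >= t outside it, so that only averages, of which there are finitely many,
need a comparison of the two measures. *)
Lemma convex_hull_comparison (E1 E2 : (T -> R) -> R) (p : I -> R) (t0 : R)
    (l : nat) (q : nat -> nat) (delta beta : nat -> R) :
  positive_linear E1 -> positive_linear E2 ->
  E1 (fun=> 1) = 1 -> E2 (fun=> 1) = 1 ->
  (forall a, 0 <= p a) -> \sum_a p a = 1 ->
  0 < t0 -> B <= 2 * level t0 l ->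
  (forall i : 'I_l, [/\ (0 < q i)%N, level t0 i <= 8 * B &
    4 * expR (- ((q i)%:R * (level t0 i / 2) ^+ 2 / (32 * B ^+ 2))) <= beta i]) ->
  (forall (i : 'I_l) (f : {ffun 'I_(q i) -> I}),
     E1 (fun x => (3 / 2 * level t0 i <= `|average f x|)%R%:R) / 2 - delta i <=
     E2 (fun x => (3 / 2 * level t0 i <= `|average f x|)%R%:R)) ->
  3 / 128 * (E1 (fun x => combination p x ^+ 2) - 4 * t0 ^+ 2) -
    3 / 4 * \sum_(i < l) level t0 i ^+ 2 * (delta i + beta i) <=
  E2 (fun x => combination p x ^+ 2).
Proof.
move=> hE1 hE2 E11 E21 p0 p1 t00 Bl hq net.
pose Fp := combination p.
have bmFp : bounded_measurable Fp by exact: bounded_measurable_combination.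
have bmFp2 : bounded_measurable (fun x => Fp x ^+ 2).
  by apply: bounded_measurableM.
pose a (i : nat) x : R := (2 * level t0 i <= `|Fp x|)%R%:R.
pose b (i : nat) x : R := (level t0 i <= `|Fp x|)%R%:R.
have bma i : bounded_measurable (a i).
  by apply: bounded_measurable_superlevel; case: bmFp.
have bmb i : bounded_measurable (b i).
  by apply: bounded_measurable_superlevel; case: bmFp.
have key (i : 'I_l) : E1 (a i) / 2 - (delta i + beta i) <= E2 (b i).
  have [q0 tB hbeta] := hq i.
  have ti0 : 0 < level t0 i by rewrite mulr_gt0 // exprn_gt0.
  have u0 : 0 < level t0 i / 2 by rewrite divr_gt0.
  have uB : level t0 i / 2 <= 4 * B by lra.
  have [f] := maurey (positive_linearD hE1 hE2) p0 p1 u0 uB q0.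
  rewrite E11 E21 => hf.
  pose g x : R := (3 / 2 * level t0 i <= `|average f x|)%R%:R.
  pose e x : R := (level t0 i / 2 <= `|Fp x - average f x|)%R%:R.
  have bmG := bounded_measurable_average f.
  have bmg : bounded_measurable g.
    by apply: bounded_measurable_superlevel; case: bmG.
  have bme : bounded_measurable e.
    by apply: bounded_measurable_superlevel; case: (bounded_measurableB bmFp bmG).
  have e10 : 0 <= E1 e by apply: positive_linear_ge0 => // x; rewrite /e.
  have ag x : a i x <= g x + e x.
    rewrite /a /g /e; case: (leP (2 * _)) => h1; last by rewrite addr_ge0.
    case: (leP (3 / 2 * _)) => h2; first by rewrite lerDl.
    case: (leP (_ / 2)) => h3; first by rewrite add0r.
    have := ler_normD (Fp x - average f x) (average f x).
    by rewrite subrK; lra.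
  have gb x : g x <= b i x + e x.
    rewrite /b /g /e; case: (leP (3 / 2 * _)) => h1; last by rewrite addr_ge0.
    case: (leP (level t0 i) `|Fp x|) => h2; first by rewrite lerDl.
    case: (leP (_ / 2)) => h3; first by rewrite add0r.
    have := ler_normD (average f x - Fp x) (Fp x).
    by rewrite subrK distrC; lra.
  have h1 : E1 (a i) <= E1 g + E1 e.
    case: hE1 => D _ M; rewrite -D //; apply: M => //.
    exact: bounded_measurableD.
  have h2 : E2 g <= E2 (b i) + E2 e.
    case: hE2 => D _ M; rewrite -D //; apply: M => //.
    exact: bounded_measurableD.
  have h3 := net i f; rewrite -/g in h3.
  have h4 : E1 e + E2 e <= beta i.
    by apply: (le_trans hf); apply: le_trans hbeta; lra.
  lra.
have h2 : 3 / 4 * \sum_(i < l) level t0 i ^+ 2 * E2 (b i) <=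
    E2 (fun x => Fp x ^+ 2).
  rewrite -positive_linear_sumZ //; case: (hE2) => _ Z M.
  have bms : bounded_measurable (fun x => \sum_(i < l) level t0 i ^+ 2 * b i x).
    by apply: bounded_measurable_sum => i; exact: bounded_measurableZ.
  rewrite -Z //; apply: M => // [|x]; first exact: bounded_measurableZ.
  by have := level_sum_le_sq (Fp x) l t00; rewrite /b; lra.
have h1 : E1 (fun x => Fp x ^+ 2) <=
    4 * t0 ^+ 2 + 16 * \sum_(i < l) level t0 i ^+ 2 * E1 (a i).
  rewrite -positive_linear_sumZ //; case: (hE1) => D Z M.
  have bms : bounded_measurable (fun x => \sum_(i < l) level t0 i ^+ 2 * a i x).
    by apply: bounded_measurable_sum => i; exact: bounded_measurableZ.
  have c4 : E1 (fun=> 4 * t0 ^+ 2) = 4 * t0 ^+ 2.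
    rewrite -[RHS]mulr1 -[X in _ = _ * X]E11 -Z; last exact: bounded_measurable_cst.
    by congr E1; apply/funext => x; rewrite mulr1.
  rewrite -c4 -Z // -D; [|exact: bounded_measurable_cst|exact: bounded_measurableZ].
  apply: M => // [|x].
    by apply: bounded_measurableD; [exact: bounded_measurable_cst|exact: bounded_measurableZ].
  exact: sq_le_level_sum t00 (le_trans (combination_le x p0 p1) Bl).
have h3 : \sum_(i < l) level t0 i ^+ 2 * E1 (a i) / 2 -
    \sum_(i < l) level t0 i ^+ 2 * (delta i + beta i) <=
    \sum_(i < l) level t0 i ^+ 2 * E2 (b i).
  rewrite -sumrB; apply: ler_sum => i _; rewrite -mulrA -mulrBr.
  by rewrite ler_wpM2l ?sqr_ge0.
rewrite -mulr_suml in h3; rewrite -/Fp.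
lra.
Qed.

End ConvexHull.

(** * Means, events of high probability and the lower Chernoff bound *)

Section Mean.
Context {R : realType} {d : measure_display} {T : measurableType d}.
Variable nu : probability T R.
Implicit Types f g : T -> R.

Lemma bounded_measurable_integrable f : bounded_measurable f ->
  nu.-integrable [set: T] (EFin \o f).
Proof.
move=> [mf [M hM]]; apply: measurable_bounded_integrable => //.
  exact: fin_num_fun_lty.
exists M; split; first exact: num_real.
by move=> y yM x _ /=; rewrite (le_trans (hM x)) // ltW.
Qed.

Definition mean f : R := \int[nu]_(x in [set: T]) f x.

Lemma mean_positive_linear : positive_linear mean.
Proof.
split=> [f g hf hg|c f hf|f g hf hg fg]; rewrite /mean.
- by rewrite RintegralD //; exact: bounded_measurable_integrable.
- by rewrite RintegralZl //; exact: bounded_measurable_integrable.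
- by apply: le_Rintegral => //; exact: bounded_measurable_integrable.
Qed.

Lemma mean1 : mean (fun=> 1) = 1.
Proof.
by rewrite /mean Rintegral_cst // mul1r; exact: (congr1 fine (probability_setT nu)).
Qed.

Lemma mean_superlevel (c : R) f : measurable_fun [set: T] f ->
  mean (fun x => (c <= `|f x|)%R%:R) = fine (nu [set x | (c <= `|f x|)%R]).
Proof.
move=> mf; rewrite /mean /Rintegral; congr fine.
rewrite -[X in nu X]setIT -integral_indic //; last exact: measurable_superlevel.
by apply: eq_integral => x _; rewrite indicE mem_setE.
Qed.

End Mean.

Section Empirical.
Context {R : realType} {d : measure_display} {T : measurableType d}.

Definition empirical_mean m (t : 'I_m -> T) (f : T -> R) : R :=
  m%:R^-1 * \sum_k f (t k).

Lemma empirical_mean_positive_linear m (t : 'I_m -> T) :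
  positive_linear (empirical_mean t).
Proof.
split=> [f g _ _|c f _|f g _ _ fg]; rewrite /empirical_mean.
- by rewrite big_split mulrDr.
- by rewrite -mulr_sumr mulrCA.
- by rewrite ler_wpM2l ?invr_ge0 //; exact: ler_sum.
Qed.

Lemma empirical_mean1 m (t : 'I_m -> T) : (0 < m)%N ->
  empirical_mean t (fun=> 1) = 1.
Proof.
by move=> m0; rewrite /empirical_mean sumr_const card_ord mulVf // pnatr_eq0 -lt0n.
Qed.

End Empirical.

Section Likely.
Context {R : realType} {d : measure_display} {Omega : measurableType d}.
Variable P : probability Omega R.
Implicit Types (b : R) (Q : Omega -> Prop).

(** A property quantified over all vectors need not define a measurable event, so
it is only required to contain one of probability at least 1 - b. *)
Definition likely b Q : Prop :=
  exists G : set Omega,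
    [/\ measurable G, ((1 - b)%:E <= P G)%E & forall w, G w -> Q w].

Lemma likely_mono b b' Q Q' : b <= b' -> (forall w, Q w -> Q' w) ->
  likely b Q -> likely b' Q'.
Proof.
move=> bb QQ [G [mG PG GQ]]; exists G; split => // [|w /GQ /QQ //].
by apply: le_trans PG; rewrite lee_fin lerD2l lerN2.
Qed.

Lemma likely_of_unlikely b (bad : set Omega) Q : measurable bad ->
  (P bad <= b%:E)%E -> (forall w, ~ bad w -> Q w) -> likely b Q.
Proof.
move=> mbad Pbad h; exists (~` bad); split => //; first exact: measurableC.
rewrite probability_setC // EFinB; apply: leeB => //.
Qed.

Lemma likely_and b b' Q Q' : likely b Q -> likely b' Q' ->
  likely (b + b') (fun w => Q w /\ Q' w).
Proof.
move=> [G [mG PG GQ]] [G' [mG' PG' GQ']].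
apply: (@likely_of_unlikely _ (~` G `|` ~` G')).
- by apply: measurableU; exact: measurableC.
- apply: (le_trans (measureU2 _ (measurableC mG) (measurableC mG'))).
  have aux (A : set Omega) c : measurable A -> ((1 - c)%:E <= P A)%E ->
      (P (~` A) <= c%:E)%E.
    move=> mA; rewrite probability_setC //.
    have := probability_le1 P mA; case: (P A) (measure_ge0 P A) => //= r.
    by rewrite -EFinB !lee_fin => _ _; lra.
  by rewrite EFinD leeD // aux.
- by move=> w /not_orP[/contrapT Gw /contrapT Gw']; split; [exact: GQ|exact: GQ'].
Qed.

Lemma likely_true Q : (forall w, Q w) -> likely 0 Q.
Proof.
by move=> h; exists setT; split => //; rewrite subr0 probability_setT.
Qed.

Lemma likely_forall (I : finType) (b : I -> R) (Q : I -> Omega -> Prop) :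
  (forall i, likely (b i) (Q i)) ->
  likely (\sum_i b i) (fun w => forall i, Q i w).
Proof.
move=> h.
suff H (r : seq I) : likely (\sum_(i <- r) b i) (fun w => forall i, i \in r -> Q i w).
  by have := H (index_enum I); apply: likely_mono => // w hw i;
    apply: hw; rewrite mem_index_enum.
elim: r => [|i r ih]; first by rewrite big_nil; exact: likely_true.
rewrite big_cons; have := likely_and (h i) ih.
apply: likely_mono => // w [hi hr] j; rewrite inE => /orP[/eqP -> //|]; exact: hr.
Qed.

Lemma measure_bigsetU_le (I : Type) (r : seq I) (p : pred I) (F : I -> set Omega) :
  (forall i, measurable (F i)) ->
  (P (\big[setU/set0]_(i <- r | p i) F i) <= \sum_(i <- r | p i) P (F i))%E.
Proof.
move=> mF; elim: r => [|i r ih]; first by rewrite !big_nil measure0.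
rewrite !big_cons; case: ifP => // _.
apply: le_trans (leeD2l _ ih); apply: measureU2 => //.
exact: bigsetU_measurable.
Qed.

End Likely.

Section Chernoff.
Context {R : realType} {d d' : measure_display}.
Context {Omega : measurableType d} {T : measurableType d'}.
Variables (P : probability Omega R) (nu : probability T R).
Variables (m : nat) (tau : 'I_m -> {RV P >-> T}).
Hypothesis iid : iid_samples nu tau.

Lemma sample_prob k (B : set T) : measurable B -> P (tau k @^-1` B) = nu B.
Proof. by case: iid => _ h mB; rewrite -(h k B mB). Qed.

Lemma measurable_sample k (B : set T) : measurable B ->
  measurable (tau k @^-1` B).
Proof.
by move=> mB; rewrite -[X in measurable X]setTI;
  exact: (@measurable_funPT _ _ _ _ (tau k)).
Qed.

Lemma pattern_prob (B : set T) (J : {set 'I_m}) : measurable B ->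
  let E := \bigcap_(k in [set k | k \in [set: 'I_m]%SET])
     (tau k @^-1` (if k \in J then B else ~` B)) in
  measurable E /\
  P E = (\prod_(k : 'I_m) (if k \in J then fine (nu B) else 1 - fine (nu B)))%:E.
Proof.
move=> mB /=; pose C k := if k \in J then B else ~` B.
have mC k : measurable (C k).
  by rewrite /C; case: ifP => // _; exact: measurableC.
split.
  have -> : [set k | k \in [set: 'I_m]%SET] = setT.
    by apply/seteqP; split=> k //= _; rewrite inE.
  apply: fin_bigcap_measurable; first exact: finite_finset.
  by move=> k _; exact: measurable_sample (mC k).
case: iid => ind _; rewrite (ind _ C mC) -prodEFin.
apply: eq_big => [k|k _]; first by rewrite inE.
rewrite sample_prob // /C; case: ifP => // _; first by rewrite fineK ?fin_num_measure.
by rewrite probability_setC // EFinB fineK ?fin_num_measure.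
Qed.

(** Each pattern [J] with at most [c] elements is charged exp (c - #|J|) >= 1;
the sum over all patterns then factors into the [m]-th power of
1 - q (1 - 1/e) <= exp (- q / 2). *)
Lemma card_pattern_bound (q c : R) : 0 <= q -> q <= 1 ->
  \sum_(J : {set 'I_m} | #|J|%:R <= c)
     \prod_(k : 'I_m) (if k \in J then q else 1 - q) <=
  expR (c - m%:R * q / 2).
Proof.
move=> q0 q1.
have e2 : 2 <= expR 1 :> R by have := @expR_ge1Dx R 1; lra.
have em : expR (- 1) <= 2^-1 :> R by rewrite expRN lef_pV2 ?posrE ?expR_gt0.
have pr0 (J : {set 'I_m}) : 0 <= \prod_(k : 'I_m) (if k \in J then q else 1 - q).
  by apply: prodr_ge0 => k _; case: ifP => // _; lra.
have step (J : {set 'I_m}) : #|J|%:R <= c ->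
   \prod_(k : 'I_m) (if k \in J then q else 1 - q) <=
   expR c * \prod_(k : 'I_m) (if k \in J then q * expR (- 1) else 1 - q).
  move=> Jc; have -> : \prod_(k : 'I_m) (if k \in J then q * expR (- 1) else 1 - q) =
      \prod_(k : 'I_m) (if k \in J then q else 1 - q) * expR (- #|J|%:R).
    rewrite -sumr_const -sumrN expR_sum.
    rewrite [X in _ = _ * X]big_mkcond -big_split /=.
    by apply: eq_bigr => k _; case: ifP; rewrite ?mulr1.
  rewrite mulrCA -expRD -[leLHS]mulr1 ler_wpM2l //.
  by rewrite (le_trans _ (expR_ge1Dx _)) // lerDl; lra.
apply: (le_trans (ler_sum _ step)).
apply: (@le_trans _ _ (\sum_(J : {set 'I_m}) expR c *
    \prod_(k : 'I_m) (if k \in J then q * expR (- 1) else 1 - q))).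
  rewrite [leRHS](bigID (fun J : {set 'I_m} => #|J|%:R <= c)) /= lerDl.
  apply: sumr_ge0 => J _; rewrite mulr_ge0 ?expR_ge0 // prodr_ge0 // => k _.
  by case: ifP => _; rewrite ?mulr_ge0 ?expR_ge0 //; lra.
rewrite -mulr_sumr.
have -> : \sum_(J : {set 'I_m}) \prod_(k : 'I_m)
    (if k \in J then q * expR (- 1) else 1 - q) =
    \prod_(k : 'I_m) (q * expR (- 1) + (1 - q)) by rewrite bigA_distr.
rewrite prodr_const card_ord expRD ler_wpM2l ?expR_ge0 //.
apply: (@le_trans _ _ (expR (- (q / 2)) ^+ m)).
  rewrite lerXn2r ?nnegrE ?expR_ge0 //.
    by have := expR_ge0 (-1 : R); nra.
  by have := expR_ge1Dx (- (q / 2)); nra.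
by rewrite -expRM_natr ler_expR le_eqVlt; apply/orP; left; apply/eqP; ring.
Qed.

(** For c = m q / 2 - m delta the bound exp (c - m q / 2) is exp (- m delta)
whatever the probability q of [B] is, which makes the estimate useful for events
of arbitrarily small probability. *)
Lemma chernoff_lower (B : set T) (delta : R) : measurable B ->
  likely P (expR (- (m%:R * delta)))
    (fun w => fine (nu B) / 2 - delta <=
       m%:R^-1 * \sum_k (tau k w \in B)%:R).
Proof.
move=> mB; set q := fine (nu B).
have q0 : 0 <= q by exact: fine_ge0.
have q1 : q <= 1 by rewrite -lee_fin fineK ?fin_num_measure ?probability_le1.
pose c := m%:R * q / 2 - m%:R * delta.
pose E (J : {set 'I_m}) := \bigcap_(k in [set k | k \in [set: 'I_m]%SET])
     (tau k @^-1` (if k \in J then B else ~` B)).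
have mE J : measurable (E J) by case: (pattern_prob J mB).
(* the samples falling into B form one of the patterns J with #|J| <= c *)
apply: (@likely_of_unlikely _ _ _ P _ (\big[setU/set0]_(J : {set 'I_m} | #|J|%:R <= c) E J)).
- exact: bigsetU_measurable.
- apply: (le_trans (measure_bigsetU_le P _ _ mE)).
  rewrite (eq_bigr (fun J : {set 'I_m} =>
     (\prod_(k : 'I_m) (if k \in J then q else 1 - q))%:E)) => [|J _]; last first.
    by case: (pattern_prob J mB).
  rewrite sumEFin lee_fin; apply: (le_trans (card_pattern_bound c q0 q1)).
  by rewrite ler_expR /c; lra.
- move=> w hw; rewrite leNgt; apply/negP => hlt; apply: hw.
  pose J := [set k | tau k w \in B]%SET.
  have cardJ : \sum_k (tau k w \in B)%:R = #|J|%:R :> R.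
    rewrite -sum1_card natr_sum [RHS]big_mkcond /=.
    by apply: eq_bigr => k _; rewrite inE; case: (_ \in _).
  have Jc : #|J|%:R <= c.
    move: hlt; rewrite cardJ /c; have [m0|m0] := posnP m.
      have -> : #|J| = 0%N.
        by apply/eqP; rewrite -leqn0 -[X in (_ <= X)%N]m0 -[leqRHS]card_ord max_card.
      by rewrite (_ : m%:R = 0) ?m0 // !mul0r subrr.
    rewrite mulrC ltr_pdivrMr ?ltr0n // => /ltW; lra.
  rewrite (bigD1 J) //=; left => k _ /=.
  by case: ifPn; rewrite inE; [rewrite inE|move/negP; rewrite inE].
Qed.

End Chernoff.

(** * Independent pairs and the uniform lower bound over a convex hull *)

Section Pairs.
Context {R : realType} {d d' : measure_display}.
Context {Omega : measurableType d} {T : measurableType d'}.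
Variables (P : probability Omega R) (nu : probability T R).

(** The law of (X, Y) agrees with the product measure on rectangles, hence
everywhere, and Fubini's theorem splits the integral. *)
Lemma mean_independent_product (X Y : {RV P >-> T}) (f g : T -> R) :
  (forall A B, measurable A -> measurable B ->
     P (X @^-1` A `&` Y @^-1` B) = (nu A * nu B)%E) ->
  bounded_measurable f -> bounded_measurable g ->
  mean P (fun w => f (X w) * g (Y w)) = mean nu f * mean nu g.
Proof.
move=> ind hf hg.
pose Z w := (X w, Y w).
have mX : measurable_fun [set: Omega] X by exact: measurable_funPT.
have mY : measurable_fun [set: Omega] Y by exact: measurable_funPT.
have mZ : measurable_fun [set: Omega] Z by exact: measurable_fun_pair.
pose mixZ := isMeasurableFun.Build _ _ _ _ Z mZ.
pose ZRV : {mfun Omega >-> (T * T)%type} := HB.pack Z mixZ.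
pose h (z : T * T) : R := f z.1 * g z.2.
have bmh : bounded_measurable h.
  apply: bounded_measurableM; [case: hf|case: hg] => mh [M hM].
  - by split; [exact: measurableT_comp | exists M => z].
  - by split; [exact: measurableT_comp | exists M => z].
have bmhZ : bounded_measurable (h \o Z).
  case: bmh => mh [M hM]; split; last by exists M => w; exact: hM.
  exact: measurableT_comp.
have prodE A : measurable A -> (nu \x nu)%E A = distribution P ZRV A.
  by apply: product_measure_unique => B C mB mC; rewrite -ind.
have int_h : (nu \x nu)%E.-integrable [set: T * T] (EFin \o h).
  case: bmh => mh [M hM]; apply: measurable_bounded_integrable.
  - exact: measurableT.
  - have h1 : (nu \x nu)%E [set: T * T] = 1%E.
      by rewrite prodE //; exact: probability_setT.
    exact: (eq_ind_r (fun x => (x < +oo)%E) (ltry 1) h1).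
  - exact: mh.
  exists M; split; first exact: num_real.
  by move=> y yM x _ /=; rewrite (le_trans (hM x)) // ltW.
rewrite /mean {1}/Rintegral.
have -> : (\int[P]_w (f (X w) * g (Y w))%:E =
           \int[distribution P ZRV]_z (h z)%:E)%E.
  rewrite integral_distribution //.
    by apply/measurable_EFinP; case: bmh.
  exact: bounded_measurable_integrable.
have -> : (\int[distribution P ZRV]_z (h z)%:E = \int[nu \x nu]_z (h z)%:E)%E.
  by apply: eq_measure_integral => A mA _; apply/esym; exact: prodE.
rewrite -(integral12_prod_meas1 int_h) /fubini_F /=.
have intE (k : T -> R) : bounded_measurable k ->
    (\int[nu]_x (k x)%:E = (\int[nu]_x k x)%:E)%E.
  move=> hk; rewrite /Rintegral fineK //.
  by apply: integrable_fin_num => //; exact: bounded_measurable_integrable.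
under eq_integral => x _.
  rewrite (_ : (\int[nu]_y (h (x, y))%:E)%E = (f x * \int[nu]_y g y)%:E); last first.
    rewrite (intE (fun y => h (x, y))); last exact: (bounded_measurableZ (f x) hg).
    by rewrite /h /= RintegralZl //; exact: bounded_measurable_integrable.
  over.
rewrite (intE (fun x => f x * \int[nu]_y g y)) /=; last first.
  by apply: bounded_measurableM => //; exact: bounded_measurable_cst.
by rewrite RintegralZr //; exact: bounded_measurable_integrable.
Qed.

Lemma mean_sample_pair m (tau : 'I_m -> {RV P >-> T}) (k l : 'I_m) (f g : T -> R) :
  iid_samples nu tau -> k != l ->
  bounded_measurable f -> bounded_measurable g ->
  mean P (fun w => f (tau k w) * g (tau l w)) = mean nu f * mean nu g.
Proof.
move=> iid kl; apply: mean_independent_product => A B mA mB.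
case: (iid) => ind _.
pose C (j : 'I_m) := if j == k then A else B.
have mC j : measurable (C j) by rewrite /C; case: ifP.
have := ind [set k; l]%SET C mC.
rewrite big_setU1 ?inE // big_set1 /C eqxx eq_sym (negbTE kl).
rewrite !(sample_prob iid) // => <-; congr (P _).
apply/seteqP; split=> w /=.
  move=> [Aw Bw] j /=; rewrite !inE => /orP[/eqP ->|/eqP ->]; first by rewrite eqxx.
  by rewrite eq_sym (negbTE kl).
move=> h; split.
  by have := h k; rewrite /= !inE !eqxx => /(_ isT).
by have := h l; rewrite /= !inE !eqxx orbT eq_sym (negbTE kl) => /(_ isT).
Qed.

End Pairs.

Section UniformLowerBound.
Context {R : realType} {d d' : measure_display}.
Context {Omega : measurableType d} {T : measurableType d'}.
Variables (P : probability Omega R) (nu : probability T R).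
Variables (m : nat) (tau : 'I_m -> {RV P >-> T}).
Hypothesis iid : iid_samples nu tau.
Hypothesis m0 : (0 < m)%N.

(** The lower Chernoff bound is applied to the event |G| >= 3t/2 for every
average G of [q i] atoms at every level; a union bound over these finitely many
events provides the hypothesis of [convex_hull_comparison] simultaneously for
all combinations. *)
Lemma convex_hull_lower_bound (I : finType) (F : I -> T -> R) (B t0 : R) (l : nat)
    (q : nat -> nat) (delta : nat -> R) :
  (forall a, bounded_measurable (F a)) -> (forall a x, `|F a x| <= B) ->
  0 < B -> 0 < t0 -> B <= 2 * level t0 l ->
  (forall i : 'I_l, [/\ (0 < q i)%N, level t0 i <= 8 * B &
    4 * expR (- ((q i)%:R * (level t0 i / 2) ^+ 2 / (32 * B ^+ 2))) <= delta i]) ->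
  likely P (\sum_(i < l) #|I|%:R ^+ q i * expR (- (m%:R * delta i)))
    (fun w => forall p : I -> R, (forall a, 0 <= p a) -> \sum_a p a = 1 ->
      3 / 128 * (mean nu (fun x => combination F p x ^+ 2) - 4 * t0 ^+ 2) -
      3 / 4 * \sum_(i < l) level t0 i ^+ 2 * (delta i + delta i) <=
      empirical_mean (fun k => tau k w) (fun x => combination F p x ^+ 2)).
Proof.
move=> bmF FB B0 t00 Bl hq.
have net (i : 'I_l) : likely P (#|I|%:R ^+ q i * expR (- (m%:R * delta i)))
   (fun w => forall f : {ffun 'I_(q i) -> I},
     mean nu (fun x => (3 / 2 * level t0 i <= `|average F f x|)%R%:R) / 2 - delta i <=
     empirical_mean (fun k => tau k w)
       (fun x => (3 / 2 * level t0 i <= `|average F f x|)%R%:R)).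
  have -> : #|I|%:R ^+ q i * expR (- (m%:R * delta i)) =
      \sum_(f : {ffun 'I_(q i) -> I}) expR (- (m%:R * delta i)).
    by rewrite sumr_const card_ffun card_ord -[RHS]mulr_natl natrX.
  apply: likely_forall => f.
  have [mG _] := bounded_measurable_average bmF f.
  rewrite mean_superlevel //.
  have := chernoff_lower iid (delta i) (measurable_superlevel (3 / 2 * level t0 i) mG).
  apply: likely_mono => // w; rewrite /empirical_mean => h; apply: (le_trans h).
  by rewrite le_eqVlt; apply/orP; left; apply/eqP; congr (_ * _);
    apply: eq_bigr => k _; rewrite mem_setE.
have := likely_forall net; apply: likely_mono => // w hw p p0 p1.
apply: (convex_hull_comparison bmF FB B0 (mean_positive_linear nu)
  (empirical_mean_positive_linear _) (mean1 nu) (empirical_mean1 _ m0) p0 p1 t00 Bl hq).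
exact: hw.
Qed.

(** The symmetric convex hull of [J] functions is the convex hull of their
[2 #|J|] signed copies; the unused weight is spread evenly over opposite
pairs, where it cancels. *)
Lemma symmetric_hull_lower_bound (J : finType) (F : J -> T -> R) (K M t0 : R)
    (l : nat) (q : nat -> nat) (delta : nat -> R) :
  (0 < #|J|)%N ->
  (forall j, bounded_measurable (F j)) -> (forall j x, `|F j x| <= K) ->
  0 < K -> 0 < M -> 0 < t0 -> M * K <= 2 * level t0 l ->
  (forall i : 'I_l, [/\ (0 < q i)%N, level t0 i <= 8 * (M * K) &
    4 * expR (- ((q i)%:R * (level t0 i / 2) ^+ 2 / (32 * (M * K) ^+ 2))) <= delta i]) ->
  likely P (\sum_(i < l) (2 * #|J|%:R) ^+ q i * expR (- (m%:R * delta i)))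
    (fun w => forall c : J -> R, \sum_j `|c j| <= M ->
      3 / 128 * (mean nu (fun x => (\sum_j c j * F j x) ^+ 2) - 4 * t0 ^+ 2) -
      3 / 4 * \sum_(i < l) level t0 i ^+ 2 * (delta i + delta i) <=
      empirical_mean (fun k => tau k w) (fun x => (\sum_j c j * F j x) ^+ 2)).
Proof.
move=> J0 bmF FK K0 M0 t00 Bl hq.
pose sg (b : bool) : R := if b then 1 else -1.
pose G (a : J * bool) x : R := (sg a.2 * M) * F a.1 x.
have bmG a : bounded_measurable (G a) by exact: bounded_measurableZ.
have GB a x : `|G a x| <= M * K.
  rewrite /G !normrM (gtr0_norm M0) /sg; case: a.2; rewrite ?normrN normr1 mul1r.
    by rewrite ler_wpM2l // ltW.
  by rewrite ler_wpM2l // ltW.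
have B0 : 0 < M * K by rewrite mulr_gt0.
have := convex_hull_lower_bound bmG GB B0 t00 Bl hq.
have -> : #|{: J * bool}|%:R = 2 * #|J|%:R :> R.
  by rewrite card_prod card_bool natrM mulrC.
apply: likely_mono => // w hw c cM.
have J0' : 0 < #|J|%:R :> R by rewrite ltr0n.
pose p (a : J * bool) : R := (`|c a.1| + sg a.2 * c a.1) / (2 * M) +
  (1 - (\sum_j `|c j|) / M) / (2 * #|J|%:R).
have p0 a : 0 <= p a.
  have h1 := ler_norm (- c a.1); have h2 := ler_norm (c a.1).
  rewrite normrN in h1.
  apply: addr_ge0; apply: divr_ge0.
  - by rewrite /sg; case: a.2 => /=; lra.
  - by rewrite mulr_ge0 // ltW.
  - by rewrite subr_ge0 ler_pdivrMr ?mul1r.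
  - by rewrite mulr_ge0 // ltW.
have sumJ (h : J * bool -> R) : \sum_a h a = \sum_j (h (j, true) + h (j, false)).
  rewrite (eq_bigr (fun a => h (a.1, a.2))) => [|[]//].
  rewrite -(pair_bigA _ (fun j b => h (j, b))) /=.
  by apply: eq_bigr => j _; rewrite big_bool.
have p1 : \sum_a p a = 1.
  rewrite sumJ (eq_bigr (fun j => `|c j| / M + (1 - (\sum_j `|c j|) / M) / #|J|%:R)).
    rewrite big_split /= -mulr_suml sumr_const -[_ *+ #|J|]mulr_natr.
    by field; rewrite !gt_eqF.
  by move=> j _; rewrite /p /sg /=; field; rewrite !gt_eqF.
have := hw p p0 p1.
have -> : combination G p = (fun x => \sum_j c j * F j x) :> (T -> R).
  apply/funext => x; rewrite /combination sumJ; apply: eq_bigr => j _.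
  by rewrite /p /G /sg /=; field; rewrite !gt_eqF.
by [].
Qed.

End UniformLowerBound.

(** * Complex vectors and recovery from a lower bound on a cone *)

Section Modulus.
Context {R : realType}.
Implicit Types z w : R[i].

Lemma ReD z w : complex.Re (z + w) = complex.Re z + complex.Re w.
Proof. by case: z; case: w. Qed.

Lemma ImD z w : complex.Im (z + w) = complex.Im z + complex.Im w.
Proof. by case: z; case: w. Qed.

Lemma ReM z w : complex.Re (z * w) =
  complex.Re z * complex.Re w - complex.Im z * complex.Im w.
Proof. by case: z; case: w. Qed.

Lemma ImM z w : complex.Im (z * w) =
  complex.Re z * complex.Im w + complex.Im z * complex.Re w.
Proof. by case: z; case: w. Qed.

Lemma ReJ z : complex.Re z^* = complex.Re z.
Proof. by case: z. Qed.

Lemma ImJ z : complex.Im z^* = - complex.Im z.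
Proof. by case: z. Qed.

Lemma Re_sum (I : Type) (r : seq I) (Q : pred I) (F : I -> R[i]) :
  complex.Re (\sum_(i <- r | Q i) F i) = \sum_(i <- r | Q i) complex.Re (F i).
Proof. exact: (big_morph _ ReD). Qed.

Lemma Im_sum (I : Type) (r : seq I) (Q : pred I) (F : I -> R[i]) :
  complex.Im (\sum_(i <- r | Q i) F i) = \sum_(i <- r | Q i) complex.Im (F i).
Proof. exact: (big_morph _ ImD). Qed.

Lemma modulus_sq z : modulus z ^+ 2 = complex.Re z ^+ 2 + complex.Im z ^+ 2.
Proof. by case: z => a b; rewrite /modulus /= sqr_sqrtr // addr_ge0 ?sqr_ge0. Qed.

Lemma modulus_ge0 z : 0 <= modulus z.
Proof. by case: z => a b; rewrite /modulus /= sqrtr_ge0. Qed.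

Lemma modulus0 : modulus (0 : R[i]) = 0.
Proof. by rewrite /modulus /= expr0n /= addr0 sqrtr0. Qed.

Lemma modulusD z w : modulus (z + w) <= modulus z + modulus w.
Proof. exact: le_normcD. Qed.

Lemma modulusM z w : modulus (z * w) = modulus z * modulus w.
Proof. exact: ComplexField.Normc.normcM. Qed.

Lemma modulusN z : modulus (- z) = modulus z.
Proof. exact: normcN. Qed.

Lemma modulusJ z : modulus z^* = modulus z.
Proof. by case: z => a b; rewrite /modulus /= sqrrN. Qed.

Lemma modulus_real (a : R) : modulus a%:C%C = `|a|.
Proof. by rewrite /modulus /= expr0n /= addr0 sqrtr_sqr. Qed.

Lemma normr_Re_le_modulus z : `|complex.Re z| <= modulus z.
Proof.
rewrite -ler_sqr ?nnegrE ?modulus_ge0 //.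
by rewrite modulus_sq real_normK ?num_real // lerDl sqr_ge0.
Qed.

Lemma normr_Im_le_modulus z : `|complex.Im z| <= modulus z.
Proof.
rewrite -ler_sqr ?nnegrE ?modulus_ge0 //.
by rewrite modulus_sq real_normK ?num_real // lerDr sqr_ge0.
Qed.

Lemma normr_Re_Im_le_modulus z : `|complex.Re z| + `|complex.Im z| <= 2 * modulus z.
Proof. by rewrite mulr2n mulrDl mul1r lerD ?normr_Re_le_modulus ?normr_Im_le_modulus. Qed.

End Modulus.

Section Norms.
Context {R : realType}.

Lemma cauchy_schwarz_sum (I : finType) (Q : pred I) (a b : I -> R) :
  (\sum_(i | Q i) a i * b i) ^+ 2 <=
  (\sum_(i | Q i) a i ^+ 2) * (\sum_(i | Q i) b i ^+ 2).
Proof.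
have : 0 <= \sum_(i | Q i) \sum_(j | Q j) (a i * b j - a j * b i) ^+ 2.
  by apply: sumr_ge0 => i _; apply: sumr_ge0 => j _; exact: sqr_ge0.
have -> : \sum_(i | Q i) \sum_(j | Q j) (a i * b j - a j * b i) ^+ 2 =
    \sum_(i | Q i) \sum_(j | Q j) a i ^+ 2 * b j ^+ 2 +
    \sum_(i | Q i) \sum_(j | Q j) a j ^+ 2 * b i ^+ 2 -
    2 * \sum_(i | Q i) \sum_(j | Q j) (a i * b i) * (a j * b j).
  rewrite mulr_sumr -big_split -sumrB; apply: eq_bigr => i _.
  rewrite mulr_sumr -big_split -sumrB; apply: eq_bigr => j _ /=; ring.
rewrite [X in _ + X - _]exchange_big /= -big_distrlr -[X in 2 * X]big_distrlr /=.
by lra.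
Qed.

Lemma cauchy_schwarz_sqrt (I : finType) (Q : pred I) (a b : I -> R) :
  \sum_(i | Q i) a i * b i <=
  Num.sqrt (\sum_(i | Q i) a i ^+ 2) * Num.sqrt (\sum_(i | Q i) b i ^+ 2).
Proof.
rewrite -sqrtrM; last by apply: sumr_ge0 => i _; exact: sqr_ge0.
apply: (le_trans (ler_norm _)); rewrite -sqrtr_sqr ler_wsqrtr //.
exact: cauchy_schwarz_sum.
Qed.

Variable N : nat.
Implicit Types x v : 'cV[R[i]]_N.

Lemma l1norm_ge0 x : 0 <= l1norm x.
Proof. by apply: sumr_ge0 => i _; exact: modulus_ge0. Qed.

Lemma l1normD x v : l1norm (x + v) <= l1norm x + l1norm v.
Proof.
by rewrite -big_split; apply: ler_sum => i _; rewrite mxE modulusD.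
Qed.

Lemma l2norm_ge0 x : 0 <= l2norm x.
Proof. exact: sqrtr_ge0. Qed.

Lemma l2norm_sq x : l2norm x ^+ 2 = \sum_(i < N) modulus (x i 0) ^+ 2.
Proof. by rewrite sqr_sqrtr // sumr_ge0 // => i _; exact: sqr_ge0. Qed.

Lemma l2normN x : l2norm (- x) = l2norm x.
Proof. by congr Num.sqrt; apply: eq_bigr => i _; rewrite mxE modulusN. Qed.

Lemma l2normB x v : l2norm (x - v) = l2norm (v - x).
Proof. by rewrite -opprB l2normN. Qed.

Lemma l2norm_eq0 x : l2norm x = 0 -> x = 0.
Proof.
move=> h; have := l2norm_sq x; rewrite h expr0n /= => /esym/psumr_eq0P h0.
apply/matrixP => i j; rewrite (ord1 j) mxE; apply: ComplexField.Normc.eq0_normc.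
have /eqP := h0 (fun i _ => sqr_ge0 _) i isT.
by rewrite sqrf_eq0 => /eqP.
Qed.

Lemma l2normZ (a : R) x : l2norm (a%:C%C *: x) = `|a| * l2norm x.
Proof.
rewrite /l2norm -[`|a|]ger0_norm // -sqrtr_sqr -sqrtrM ?sqr_ge0 //.
congr Num.sqrt; rewrite mulr_sumr; apply: eq_bigr => i _.
by rewrite mxE modulusM modulus_real exprMn.
Qed.

Lemma l2normD x v : l2norm (x + v) <= l2norm x + l2norm v.
Proof.
rewrite -ler_sqr ?nnegrE ?addr_ge0 ?l2norm_ge0 //.
rewrite l2norm_sq sqrrD !l2norm_sq.
apply: (@le_trans _ _ (\sum_(i < N) (modulus (x i 0) + modulus (v i 0)) ^+ 2)).
  apply: ler_sum => i _; rewrite mxE lerXn2r ?nnegrE ?addr_ge0 ?modulus_ge0 //.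
  exact: modulusD.
have -> : \sum_(i < N) (modulus (x i 0) + modulus (v i 0)) ^+ 2 =
    \sum_(i < N) modulus (x i 0) ^+ 2 +
    2 * (\sum_(i < N) modulus (x i 0) * modulus (v i 0)) +
    \sum_(i < N) modulus (v i 0) ^+ 2.
  by rewrite mulr_sumr -!big_split; apply: eq_bigr => i _ /=; ring.
rewrite lerD2r lerD2l -[leRHS]mulr_natl ler_wpM2l //.
exact: cauchy_schwarz_sqrt.
Qed.

Lemma sum_modulus_le (S : {pred 'I_N}) (s : nat) x : (#|S| <= s)%N ->
  \sum_(i in S) modulus (x i 0) <= Num.sqrt s%:R * l2norm x.
Proof.
move=> Ss.
have := cauchy_schwarz_sqrt (mem S) (fun=> 1) (fun i => modulus (x i 0)).
under eq_bigr do rewrite mul1r.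
move=> h; apply: (le_trans h).
apply: ler_pM; rewrite ?sqrtr_ge0 // ler_wsqrtr //.
  by rewrite expr1n sumr_const ler_nat.
rewrite [leRHS](bigID (mem S)) /= lerDl.
by apply: sumr_ge0 => i _; exact: sqr_ge0.
Qed.

Lemma l1norm_le_l2norm x : l1norm x <= Num.sqrt N%:R * l2norm x.
Proof.
have := @sum_modulus_le predT N x; rewrite -[X in (_ <= X)%N -> _]card_ord.
by rewrite max_card => /(_ isT).
Qed.

Lemma sparse0 s : sparse s (0 : 'cV[R[i]]_N).
Proof. by rewrite /sparse eq_card0 // => i; rewrite !inE mxE eqxx. Qed.

Lemma le_best_approx_l1 (a : R) s x :
  (forall z, sparse s z -> a <= l1norm (x - z)) -> a <= best_approx_l1 s x.
Proof.
move=> h; apply: lb_le_inf; first by exists (l1norm (x - 0)), 0 => //; exact: sparse0.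
by move=> _ [z sz <-]; exact: h.
Qed.

Lemma best_approx_l1_le s x z : sparse s z -> best_approx_l1 s x <= l1norm (x - z).
Proof.
move=> sz; apply: ge_inf; last by exists z.
by exists 0 => _ [u _ <-]; exact: l1norm_ge0.
Qed.

Lemma best_approx_l1D s x v :
  best_approx_l1 s (x + v) <= best_approx_l1 s x + l1norm v.
Proof.
rewrite -lerBlDr; apply: le_best_approx_l1 => z sz; rewrite lerBlDr.
apply: (le_trans (best_approx_l1_le _ sz)).
by rewrite addrAC; exact: l1normD.
Qed.

End Norms.

Section Recovery.
Context {R : realType}.
Variables (m N s : nat) (A : 'M[R[i]]_(m, N)).
Hypothesis s0 : (0 < s)%N.

(** Let h = xhat - x. With S the support of a sparse z, every entry satisfies
|h_i| <= 2 [i in S] |h_i| + 2 |x_i - z_i| + (|xhat_i| - |x_i|), and the last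
bracket sums to a nonpositive number by minimality. *)
Lemma qcbp_recovery (kappa eta : R) (x xhat : 'cV[R[i]]_N) (y : 'cV[R[i]]_m) :
  0 < kappa ->
  (forall v : 'cV[R[i]]_N, l1norm v <= 4 * Num.sqrt s%:R * l2norm v ->
     kappa * l2norm v <= l2norm (A *m v)) ->
  l2norm (A *m x - y) <= eta -> qcbp_minimizer A y eta xhat ->
  l2norm (xhat - x) <= best_approx_l1 s x / Num.sqrt s%:R + 2 / kappa * eta.
Proof.
move=> k0 cone xfeas [hfeas hmin].
have l1 := hmin x xfeas.
set h := xhat - x.
have sq0 : 0 < Num.sqrt s%:R :> R by rewrite sqrtr_gt0 ltr0n.
rewrite -lerBlDr ler_pdivlMr //; apply: le_best_approx_l1 => z sz.
rewrite -ler_pdivlMr // lerBlDr.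
pose S := [pred i : 'I_N | (z i 0 != 0)%R].
have l1h : l1norm h <= 2 * \sum_(i in S) modulus (h i 0) + 2 * l1norm (x - z) +
    (l1norm xhat - l1norm x).
  rewrite [\sum_(i in S) _]big_mkcond !mulr_sumr -sumrB -!big_split /=.
  apply: ler_sum => i _; rewrite /h !mxE inE.
  set hi := xhat i 0 - x i 0.
  have e1 : xhat i 0 = hi + x i 0 by rewrite /hi subrK.
  have e2 : hi = xhat i 0 - x i 0 by [].
  have e3 : x i 0 = xhat i 0 - hi by rewrite /hi subKr.
  have t2 := modulusD (xhat i 0) (- x i 0); rewrite -e2 modulusN in t2.
  have t3 := modulusD (xhat i 0) (- hi); rewrite -e3 modulusN in t3.
  have := modulus_ge0 (x i 0 - z i 0); have := modulus_ge0 hi.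
  case: ifPn => [_|/negPn/eqP ->]; first by lra.
  by rewrite subr0; lra.
have S1 := sum_modulus_le h sz; rewrite -/S in S1.
have h0 := l2norm_ge0 h.
have z0 := l1norm_ge0 (x - z).
have eta0 : 0 <= 2 / kappa * eta.
  by rewrite mulr_ge0 ?divr_ge0 ?(ltW k0) //; exact: le_trans (l2norm_ge0 _) xfeas.
case: (lerP (l1norm (x - z)) (Num.sqrt s%:R * l2norm h)) => cs.
  have /cone hA : l1norm h <= 4 * Num.sqrt s%:R * l2norm h by lra.
  have Ah : l2norm (A *m h) <= eta + eta.
    have -> : A *m h = (A *m xhat - y) + (y - A *m x).
      by rewrite /h mulmxBr addrA subrK.
    apply: (le_trans (l2normD _ _)); rewrite lerD //.
    by rewrite l2normB.
  have h1 : l2norm h <= 2 / kappa * eta.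
    by rewrite mulrAC ler_pdivlMr // mulrC; lra.
  by apply: (le_trans h1); rewrite lerDr divr_ge0 // ltW.
have h1 : l2norm h <= l1norm (x - z) / Num.sqrt s%:R.
  by rewrite ler_pdivlMr // mulrC ltW.
by apply: (le_trans h1); rewrite lerDl.
Qed.

End Recovery.

(** * Solving A v = n with small v, and robustness to unknown noise level *)

Section Quotient.
Context {R : realType}.

Lemma conjmxM m n p (A : 'M[R[i]]_(m, n)) (B : 'M[R[i]]_(n, p)) :
  (A *m B)^t* = B^t* *m A^t*.
Proof. by rewrite trmx_mul map_mxM. Qed.

Lemma conjmxK m n (A : 'M[R[i]]_(m, n)) : A^t*^t* = A.
Proof. by apply/matrixP => i j; rewrite !mxE conjCK. Qed.

Lemma dot_self n (u : 'cV[R[i]]_n) : complex.Re ((u^t* *m u) 0 0) = l2norm u ^+ 2.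
Proof.
rewrite l2norm_sq mxE Re_sum; apply: eq_bigr => i _.
by rewrite !mxE ReM ReJ ImJ modulus_sq; ring.
Qed.

Lemma dot_le n (u v : 'cV[R[i]]_n) :
  complex.Re ((u^t* *m v) 0 0) <= l2norm u * l2norm v.
Proof.
rewrite mxE Re_sum.
apply: (le_trans _ (cauchy_schwarz_sqrt xpredT (fun i => modulus (u i 0))
  (fun i => modulus (v i 0)))).
apply: ler_sum => i _; rewrite !mxE.
apply: (le_trans (ler_norm _)); apply: (le_trans (normr_Re_le_modulus _)).
by rewrite modulusM modulusJ.
Qed.

(** The least-squares solution v = A^* u with A A^* u = n works: |v|^2 is the
inner product of u and n, hence at most |u| |n|, while gamma |u|^2 <= |v|^2. *)
Lemma solvable_of_adjoint_lower_bound m N (A : 'M[R[i]]_(m, N)) (gamma : R) :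
  0 < gamma ->
  (forall w : 'cV[R[i]]_m, gamma * l2norm w ^+ 2 <= l2norm (A^t* *m w) ^+ 2) ->
  forall n : 'cV[R[i]]_m, exists v : 'cV[R[i]]_N,
    A *m v = n /\ gamma * l2norm v ^+ 2 <= l2norm n ^+ 2.
Proof.
move=> g0 lb n; pose M := A *m A^t*.
have dotM u : complex.Re ((u^t* *m (M *m u)) 0 0) = l2norm (A^t* *m u) ^+ 2.
  by rewrite -dot_self conjmxM conjmxK /M !mulmxA.
(* the lower bound on the adjoint makes A A^* injective, hence invertible *)
have injM (u : 'cV[R[i]]_m) : M *m u = 0 -> u = 0.
  move=> Mu; have := dotM u; rewrite Mu mulmx0 mxE /= => h.
  have := lb u; rewrite -h => h1; apply: l2norm_eq0; apply/eqP.
  rewrite -sqrf_eq0 eq_le sqr_ge0 andbT.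
  by rewrite -(ler_pM2l g0) mulr0.
have Mu : M \in unitmx.
  rewrite -unitmx_tr unitmxE unitfE; apply/negP => /det0P[w w0 wM].
  have : M *m w^T = 0 by rewrite -[M]trmxK -trmx_mul wM trmx0.
  move=> /injM /(congr1 trmx); rewrite trmxK trmx0 => w00.
  by rewrite w00 eqxx in w0.
pose u := invmx M *m n; pose v := A^t* *m u.
have Mun : M *m u = n by rewrite /u mulKVmx.
exists v; split; first by rewrite /v mulmxA -/M.
have h1 : l2norm v ^+ 2 <= l2norm u * l2norm n by rewrite -dotM Mun dot_le.
have h2 := lb u; rewrite -/v in h2.
have u0 := l2norm_ge0 u; have n0 := l2norm_ge0 n.
have h3 : gamma * l2norm u <= l2norm n.
  have [uz|uz] := eqVneq (l2norm u) 0; first by rewrite uz mulr0.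
  have up : 0 < l2norm u by rewrite lt_def uz.
  by rewrite -(ler_pM2r up); nra.
nra.
Qed.

(** Diagonal entries of the Gram matrix are at least 3a, and the Frobenius norm
of the off-diagonal part, which dominates its operator norm, is at most a. *)
Lemma gram_lower_bound m N (B : 'M[R[i]]_(N, m)) (a : R) :
  0 <= a ->
  (forall k, 3 * a <= l2norm (col k B) ^+ 2) ->
  \sum_(k < m) \sum_(l < m | l != k)
    modulus (\sum_j (B j k)^* * B j l) ^+ 2 <= a ^+ 2 ->
  forall w : 'cV[R[i]]_m, 2 * a * l2norm w ^+ 2 <= l2norm (B *m w) ^+ 2.
Proof.
move=> a0 diag off w.
pose G k l := \sum_j (B j k)^* * B j l.
have Bw j : (B *m w) j 0 = \sum_k B j k * w k 0 by rewrite mxE.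
have expand : l2norm (B *m w) ^+ 2 =
    \sum_k \sum_l complex.Re ((w k 0)^* * w l 0 * G k l).
  rewrite -dot_self mxE Re_sum.
  transitivity (\sum_j \sum_k \sum_l
      complex.Re ((w k 0)^* * w l 0 * ((B j k)^* * B j l))).
    apply: eq_bigr => j _; rewrite !mxE rmorph_sum /= mulr_suml Re_sum.
    apply: eq_bigr => k _; rewrite mulr_sumr Re_sum; apply: eq_bigr => l _.
    by rewrite rmorphM /=; congr complex.Re; ring.
  rewrite exchange_big /=; apply: eq_bigr => k _.
  rewrite exchange_big /=; apply: eq_bigr => l _.
  by rewrite /G mulr_sumr Re_sum.
have Gdiag k : 3 * a <= complex.Re (G k k).
  have := diag k; rewrite l2norm_sq /G Re_sum => h; apply: (le_trans h).
  rewrite le_eqVlt; apply/orP; left; apply/eqP; apply: eq_bigr => j _.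
  by rewrite !mxE modulus_sq ReM ReJ ImJ; ring.
have Gim k : complex.Im (G k k) = 0.
  rewrite /G Im_sum big1 // => j _; rewrite ImM ReJ ImJ; ring.
pose W k := modulus (w k 0).
have W0 k : 0 <= W k by exact: modulus_ge0.
have split_diag : \sum_k \sum_l complex.Re ((w k 0)^* * w l 0 * G k l) =
   \sum_k complex.Re ((w k 0)^* * w k 0 * G k k) +
   \sum_k \sum_(l | l != k) complex.Re ((w k 0)^* * w l 0 * G k l).
  by rewrite -big_split; apply: eq_bigr => k _; rewrite (bigD1 k).
have h1 : 3 * a * l2norm w ^+ 2 <= \sum_k complex.Re ((w k 0)^* * w k 0 * G k k).
  rewrite l2norm_sq mulr_sumr; apply: ler_sum => k _.
  rewrite ReM Gim mulr0 subr0 ReM ReJ ImJ modulus_sq.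
  have := Gdiag k; have := sqr_ge0 (complex.Re (w k 0)).
  have := sqr_ge0 (complex.Im (w k 0)); nra.
have h2 : - (a * l2norm w ^+ 2) <=
    \sum_k \sum_(l | l != k) complex.Re ((w k 0)^* * w l 0 * G k l).
  have h3 : - (\sum_k \sum_(l | l != k) W k * W l * modulus (G k l)) <=
      \sum_k \sum_(l | l != k) complex.Re ((w k 0)^* * w l 0 * G k l).
    rewrite -sumrN; apply: ler_sum => k _; rewrite -sumrN; apply: ler_sum => l _.
    rewrite lerNl; apply: (le_trans _ (_ : `|complex.Re ((w k 0)^* * w l 0 * G k l)| <= _)).
      by rewrite -normrN ler_norm.
    by apply: (le_trans (normr_Re_le_modulus _)); rewrite !modulusM modulusJ.
  apply: (le_trans _ h3); rewrite lerN2.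
  rewrite (pair_big_dep xpredT (fun k l : 'I_m => l != k)) /=.
  apply: (le_trans (cauchy_schwarz_sqrt _ (fun kl => W kl.1 * W kl.2)
    (fun kl => modulus (G kl.1 kl.2)))).
  rewrite mulrC; apply: ler_pM; rewrite ?sqrtr_ge0 //.
    rewrite -(pair_big_dep xpredT (fun k l : 'I_m => l != k)
      (fun k l => modulus (G k l) ^+ 2)) /=.
    by rewrite -[leRHS]ger0_norm // -sqrtr_sqr ler_wsqrtr.
  rewrite -[leRHS]ger0_norm ?sqr_ge0 // -sqrtr_sqr ler_wsqrtr //.
  rewrite -(pair_big_dep xpredT (fun k l : 'I_m => l != k)
      (fun k l => (W k * W l) ^+ 2)) /=.
  rewrite l2norm_sq expr2 big_distrlr /=; apply: ler_sum => k _.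
  rewrite [leRHS](bigD1 k) //= -[leLHS]add0r lerD ?(mulr_ge0 (sqr_ge0 _) (sqr_ge0 _)) //.
  by apply: ler_sum => l _; rewrite exprMn.
by rewrite expand split_diag; lra.
Qed.

(** If the noise exceeds [eta], its excess is A v for a small v, and the data
become those of x + v with noise of norm [eta]; replacing x by x + v costs
|v|_1 in the best approximation error and |v|_2 in the distance. *)
Lemma qcbp_robust m N s (A : 'M[R[i]]_(m, N)) (kappa gamma : R) :
  (0 < s)%N -> 0 < kappa -> 0 < gamma ->
  (forall v : 'cV[R[i]]_N, l1norm v <= 4 * Num.sqrt s%:R * l2norm v ->
     kappa * l2norm v <= l2norm (A *m v)) ->
  (forall w : 'cV[R[i]]_m, gamma * l2norm w ^+ 2 <= l2norm (A^t* *m w) ^+ 2) ->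
  forall (x xhat : 'cV[R[i]]_N) (n : 'cV[R[i]]_m) (eta : R), 0 <= eta ->
  qcbp_minimizer A (A *m x + n) eta xhat ->
  l2norm (xhat - x) <= best_approx_l1 s x / Num.sqrt s%:R + 2 / kappa * eta +
    (Num.sqrt N%:R / Num.sqrt s%:R + 1) / Num.sqrt gamma *
      Num.max (l2norm n - eta) 0.
Proof.
move=> s0 k0 g0 cone adj x xhat n eta eta0 hmin.
have sq0 : 0 < Num.sqrt s%:R :> R by rewrite sqrtr_gt0 ltr0n.
have sg0 : 0 < Num.sqrt gamma by rewrite sqrtr_gt0.
have coef0 : 0 <= (Num.sqrt N%:R / Num.sqrt s%:R + 1) / Num.sqrt gamma.
  by rewrite divr_ge0 ?addr_ge0 ?divr_ge0 ?sqrtr_ge0.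
have [hn|hn] := lerP (l2norm n) eta.
  have feas : l2norm (A *m x - (A *m x + n)) <= eta.
    by rewrite opprD addrA subrr add0r l2normN.
  apply: (le_trans (qcbp_recovery s0 k0 cone feas hmin)).
  by rewrite lerDl mulr_ge0 // le_max lexx orbT.
have n0 : 0 < l2norm n by exact: le_lt_trans hn.
(* the fraction of the noise that is moved into the signal *)
pose a := 1 - eta / l2norm n.
have a0 : 0 <= a by rewrite subr_ge0 ler_pdivrMr // mul1r ltW.
have [v [Av vn]] := solvable_of_adjoint_lower_bound g0 adj (a%:C%C *: n).
have an : a * l2norm n = l2norm n - eta by rewrite /a; field; rewrite gt_eqF.
have feas : l2norm (A *m (x + v) - (A *m x + n)) <= eta.
  have -> : A *m (x + v) - (A *m x + n) = (a - 1)%:C%C *: n.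
    rewrite mulmxDr Av opprD addrACA subrr add0r -[X in _ - X]scale1r -scalerBl.
    by congr (_ *: _); apply/eqP; rewrite eq_complex /= oppr0 addr0 !eqxx.
  rewrite l2normZ /a addrAC subrr add0r normrN ger0_norm ?divr_ge0 ?(ltW n0) //.
  by rewrite divfK // gt_eqF.
have := qcbp_recovery s0 k0 cone feas hmin.
have v2 : l2norm v <= (l2norm n - eta) / Num.sqrt gamma.
  have mu0 : 0 <= l2norm n - eta by rewrite subr_ge0 ltW.
  have vg0 : 0 <= l2norm v * Num.sqrt gamma by rewrite mulr_ge0 ?l2norm_ge0 ?sqrtr_ge0.
  rewrite ler_pdivlMr // -ler_sqr ?nnegrE //.
  rewrite exprMn (sqr_sqrtr (ltW g0)) mulrC (le_trans vn) //.
  by rewrite l2normZ ger0_norm // an.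
have v1 := l1norm_le_l2norm v.
have tri : l2norm (xhat - x) <= l2norm (xhat - (x + v)) + l2norm v.
  have -> : xhat - x = (xhat - (x + v)) + v by rewrite opprD addrA subrK.
  exact: l2normD.
have ba := best_approx_l1D s x v.
move=> hrec.
have -> : Num.max (l2norm n - eta) 0 = l2norm n - eta.
  by apply/max_idPl; rewrite subr_ge0 ltW.
set mu := l2norm n - eta in v2 *.
apply: (le_trans tri); apply: (le_trans (lerD hrec v2)).
have h1 : best_approx_l1 s (x + v) / Num.sqrt s%:R <=
    best_approx_l1 s x / Num.sqrt s%:R +
    Num.sqrt N%:R * (mu / Num.sqrt gamma) / Num.sqrt s%:R.
  rewrite -mulrDl ler_wpM2r ?invr_ge0 ?(ltW sq0) //.
  apply: (le_trans ba); rewrite lerD2l (le_trans v1) // ler_wpM2l ?sqrtr_ge0 //.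
have -> : (Num.sqrt N%:R / Num.sqrt s%:R + 1) / Num.sqrt gamma * mu =
    Num.sqrt N%:R * (mu / Num.sqrt gamma) / Num.sqrt s%:R + mu / Num.sqrt gamma.
  by field; rewrite !gt_eqF.
by lra.
Qed.

End Quotient.

(** * Bounded orthonormal systems: isotropy and the Gram matrix of the samples *)

Section Markov.
Context {R : realType} {d : measure_display} {Omega : measurableType d}.
Variable P : probability Omega R.

Lemma markov_likely (X : Omega -> R) (a b : R) :
  bounded_measurable X -> (forall w, 0 <= X w) -> 0 < a -> mean P X <= b ->
  likely P (b / a) (fun w => X w < a).
Proof.
move=> bX X0 a0 Xb; have [mX _] := bX.
have mbad := measurable_superlevel a mX.
apply: (likely_of_unlikely mbad) => [|w /= /negP]; last first.
  by rewrite -ltNge ger0_norm.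
rewrite -(fineK (fin_num_measure P _ mbad)) lee_fin -mean_superlevel //.
rewrite ler_pdivlMr // mulrC; apply: le_trans Xb.
have bs : bounded_measurable (fun w => (a <= `|X w|)%R%:R : R).
  exact: bounded_measurable_superlevel.
have [_ Z mono] := mean_positive_linear P.
rewrite -Z //; apply: mono => // [|w]; first exact: bounded_measurableZ.
by rewrite ger0_norm //; case: (leP a) => h /=; rewrite ?mulr1 // mulr0.
Qed.

Lemma expectation_mean (X : Omega -> R) : bounded_measurable X ->
  'E_P[X]%E = (mean P X)%:E.
Proof.
move=> bX; rewrite unlock /mean /Rintegral fineK //.
by apply: integrable_fin_num => //; exact: bounded_measurable_integrable.
Qed.

Lemma bounded_measurable_max (f g : Omega -> R) :
  bounded_measurable f -> bounded_measurable g ->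
  bounded_measurable (fun x => Num.max (f x) (g x)).
Proof.
move=> [mf [M hM]] [mg [M' hM']]; split; first exact: measurable_maxr.
exists (Num.max M M') => x; rewrite le_max /Num.max.
by case: ifP => _; rewrite ?hM' ?hM ?orbT.
Qed.

Lemma bounded_measurable_bigmax (I : Type) (r : seq I) (f : I -> Omega -> R) :
  (forall i, bounded_measurable (f i)) ->
  bounded_measurable (fun x => \big[Num.max/0]_(i <- r) f i x).
Proof.
move=> hf; elim: r => [|i r ih].
  by under [X in bounded_measurable X]funext do rewrite big_nil;
    exact: bounded_measurable_cst.
by under [X in bounded_measurable X]funext do rewrite big_cons;
  exact: bounded_measurable_max.
Qed.

Lemma bounded_measurable_norm (f : Omega -> R) : bounded_measurable f ->
  bounded_measurable (fun x => `|f x|).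
Proof.
move=> [mf [M hM]]; split; last by exists M => x; rewrite normr_id.
by apply: measurableT_comp => //; exact: normr_measurable.
Qed.

Lemma bounded_measurable_comp d' (T : measurableType d') (X : {RV P >-> T}) (f : T -> R) :
  bounded_measurable f -> bounded_measurable (fun w => f (X w)).
Proof.
move=> [mf [M hM]]; split; last by exists M => w.
by apply: measurableT_comp => //; exact: measurable_funPT.
Qed.

End Markov.

Section BOS.
Context {R : realType} {d : measure_display} {T : measurableType d}.
Variables (nu : probability T R) (N : nat) (phi : 'I_N -> T -> R[i]) (K : R).
Hypothesis bos : bounded_orthonormal_system nu phi K.

Lemma bos_modulus_le j t : modulus (phi j t) <= K.
Proof.
case: bos => _ _ /(_ j) h; rewrite -lee_fin; apply: le_trans h.
by apply: ereal_sup_ubound; exists t.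
Qed.

Lemma bos_bounded_measurable_Re j : bounded_measurable (fun t => complex.Re (phi j t)).
Proof.
case: bos => /(_ j)[mre _] _ _; split => //.
by exists K => t; exact: le_trans (normr_Re_le_modulus _) (bos_modulus_le _ _).
Qed.

Lemma bos_bounded_measurable_Im j : bounded_measurable (fun t => complex.Im (phi j t)).
Proof.
case: bos => /(_ j)[_ mim] _ _; split => //.
by exists K => t; exact: le_trans (normr_Im_le_modulus _) (bos_modulus_le _ _).
Qed.

Definition gram_re j k t := complex.Re (phi j t * (phi k t)^*).
Definition gram_im j k t := complex.Im (phi j t * (phi k t)^*).

Lemma bounded_measurable_gram_re j k : bounded_measurable (gram_re j k).
Proof.
have -> : gram_re j k = (fun t => complex.Re (phi j t) * complex.Re (phi k t) +
    complex.Im (phi j t) * complex.Im (phi k t)).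
  by apply/funext => t; rewrite /gram_re ReM ReJ ImJ; ring.
have hre := bos_bounded_measurable_Re; have him := bos_bounded_measurable_Im.
by apply: bounded_measurableD; exact: bounded_measurableM.
Qed.

Lemma bounded_measurable_gram_im j k : bounded_measurable (gram_im j k).
Proof.
have -> : gram_im j k = (fun t => complex.Im (phi j t) * complex.Re (phi k t) -
    complex.Re (phi j t) * complex.Im (phi k t)).
  by apply/funext => t; rewrite /gram_im ImM ReJ ImJ; ring.
have hre := bos_bounded_measurable_Re; have him := bos_bounded_measurable_Im.
by apply: bounded_measurableB; exact: bounded_measurableM.
Qed.

Lemma mean_gram_re j k : mean nu (gram_re j k) = (j == k)%:R.
Proof.
by case: bos => _ /(_ j k) /(congr1 (@complex.Re R)) /= h _; rewrite [LHS]h; case: eqP.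
Qed.

Lemma mean_gram_im j k : mean nu (gram_im j k) = 0.
Proof.
by case: bos => _ /(_ j k) /(congr1 (@complex.Im R)) /= h _; rewrite [LHS]h; case: eqP.
Qed.

(** The values of [synthesis phi v] at the samples are sqrt m times the entries
of the measurement vector of v. *)
Definition synthesis (v : 'cV[R[i]]_N) (t : T) : R[i] := \sum_j phi j t * v j 0.

Lemma mean_synthesis_sq v :
  mean nu (fun t => complex.Re (synthesis v t) ^+ 2) +
  mean nu (fun t => complex.Im (synthesis v t) ^+ 2) = l2norm v ^+ 2.
Proof.
have [D Z _] := mean_positive_linear nu.
have hre := bos_bounded_measurable_Re; have him := bos_bounded_measurable_Im.
have bre : bounded_measurable (fun t => complex.Re (synthesis v t)).
  under [X in bounded_measurable X]funext do rewrite Re_sum.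
  apply: bounded_measurable_sum => j.
  under [X in bounded_measurable X]funext do rewrite ReM.
  by apply: bounded_measurableB; apply: bounded_measurableM => //;
    exact: bounded_measurable_cst.
have bim : bounded_measurable (fun t => complex.Im (synthesis v t)).
  under [X in bounded_measurable X]funext do rewrite Im_sum.
  apply: bounded_measurable_sum => j.
  under [X in bounded_measurable X]funext do rewrite ImM.
  by apply: bounded_measurableD; apply: bounded_measurableM => //;
    exact: bounded_measurable_cst.
rewrite -D; [|exact: bounded_measurableM|exact: bounded_measurableM].
pose a j k := complex.Re (v j 0 * (v k 0)^*).
pose b j k := complex.Im (v j 0 * (v k 0)^*).
have bgr := bounded_measurable_gram_re; have bgi := bounded_measurable_gram_im.
have -> : (fun t => complex.Re (synthesis v t) ^+ 2 + complex.Im (synthesis v t) ^+ 2) =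
    (fun t => \sum_j \sum_k (a j k * gram_re j k t + (- b j k) * gram_im j k t)).
  apply/funext => t; transitivity (complex.Re (synthesis v t * (synthesis v t)^*)).
    by rewrite ReM ReJ ImJ; ring.
  rewrite /synthesis rmorph_sum /= mulr_suml Re_sum; apply: eq_bigr => j _.
  rewrite mulr_sumr Re_sum; apply: eq_bigr => k _.
  rewrite rmorphM /= (_ : _ * _ * (_ * _) = (v j 0 * (v k 0)^*) * (phi j t * (phi k t)^*)).
    by rewrite ReM /a /b /gram_re /gram_im mulNr.
  by ring.
rewrite (positive_linear_sum (mean_positive_linear nu)); last first.
  move=> j; apply: bounded_measurable_sum => k.
  by apply: bounded_measurableD; exact: bounded_measurableZ.
rewrite l2norm_sq; apply: eq_bigr => j _.
rewrite (positive_linear_sum (mean_positive_linear nu)); last first.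
  by move=> k; apply: bounded_measurableD; exact: bounded_measurableZ.
rewrite (bigD1 j) //= big1 => [|k kj].
  rewrite addr0 D; [|exact: bounded_measurableZ|exact: bounded_measurableZ].
  rewrite !Z // mean_gram_re mean_gram_im eqxx mulr0 addr0 mulr1 /a.
  by rewrite ReM ReJ ImJ modulus_sq; ring.
rewrite D; [|exact: bounded_measurableZ|exact: bounded_measurableZ].
by rewrite !Z // mean_gram_re mean_gram_im eq_sym (negbTE kj) !mulr0 addr0.
Qed.

Section Sampling.
Context {d' : measure_display} {Omega : measurableType d'}.
Variables (P : probability Omega R) (m : nat) (tau : 'I_m -> {RV P >-> T}).
Hypothesis iid : iid_samples nu tau.
Hypothesis m0 : (0 < m)%N.
Hypothesis N0 : (0 < N)%N.

Let A w := sampling_matrix phi (fun k => tau k w).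
Let B w : 'M[R[i]]_(N, m) := (Num.sqrt m%:R)%:C%C *: (A w)^t*.

Lemma rescaled_sampling_entry w j k : B w j k = (phi j (tau k w))^*.
Proof.
rewrite !mxE rmorphM /= mulrA.
have -> : ((Num.sqrt m%:R)^-1)%:C%C^* = ((Num.sqrt m%:R)^-1)%:C%C :> R[i].
  by apply/eqP; rewrite eq_complex /= oppr0 !eqxx.
rewrite -rmorphM /= divff ?mul1r // gt_eqF // sqrtr_gt0 ltr0n //.
Qed.

Lemma col_energy w k : l2norm (col k (B w)) ^+ 2 = \sum_j gram_re j j (tau k w).
Proof.
rewrite l2norm_sq; apply: eq_bigr => j _.
by rewrite mxE rescaled_sampling_entry modulusJ modulus_sq /gram_re ReM ReJ ImJ; ring.
Qed.

Lemma diagonal_likely (xi : R) : (bos_distortion phi tau <= xi%:E)%E ->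
  likely P (4 * xi) (fun w => forall k, 3 * (N%:R / 4) <= l2norm (col k (B w)) ^+ 2).
Proof.
have N0' : 0 < N%:R :> R by rewrite ltr0n.
pose D w := \big[Num.max/0]_(k < m) `| l2norm (col k (B w)) ^+ 2 / N%:R - 1 |.
have bD : bounded_measurable D.
  apply: bounded_measurable_bigmax => k; apply: bounded_measurable_norm.
  apply: bounded_measurableB; last exact: bounded_measurable_cst.
  apply: bounded_measurableM; last exact: bounded_measurable_cst.
  under [X in bounded_measurable X]funext do rewrite col_energy.
  apply: bounded_measurable_sum => j.
  by apply: bounded_measurable_comp; exact: bounded_measurable_gram_re.
have D0 w : 0 <= D w.
  by rewrite /D; elim/big_rec: _ => // k x _ x0; rewrite le_max x0 orbT.
move=> hxi; have : mean P D <= xi.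
  by rewrite -lee_fin -expectation_mean.
move=> /(markov_likely bD D0 (_ : 0 < 4^-1)) h.
have {h} : likely P (xi / 4^-1) (fun w => D w < 4^-1) by apply: h; lra.
apply: likely_mono => [|w hw k]; first by lra.
have hk : `| l2norm (col k (B w)) ^+ 2 / N%:R - 1 | < 4^-1.
  apply: le_lt_trans hw; rewrite /D (bigD1 k) //= le_max lexx //.
move: hk; rewrite ltr_norml => /andP[hk _].
have : 3 / 4 <= l2norm (col k (B w)) ^+ 2 / N%:R by lra.
by rewrite ler_pdivlMr //; lra.
Qed.

(** The squared modulus of the entry is a double sum of products of a function
of the k-th sample and the same function of the l-th; by independence each
product has mean the square of an entry of the identity matrix. *)
Lemma mean_offdiagonal (k l : 'I_m) : k != l ->
  bounded_measurable (fun w => modulus (\sum_j (B w j k)^* * B w j l) ^+ 2) /\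
  mean P (fun w => modulus (\sum_j (B w j k)^* * B w j l) ^+ 2) = N%:R.
Proof.
move=> kl; have [D Z _] := mean_positive_linear P.
have -> : (fun w => modulus (\sum_j (B w j k)^* * B w j l) ^+ 2) =
   (fun w => \sum_i \sum_j (gram_re i j (tau k w) * gram_re i j (tau l w) +
                            gram_im i j (tau k w) * gram_im i j (tau l w))).
  apply/funext => w; set g := (X in modulus X ^+ 2 = _).
  transitivity (complex.Re (g * g^*)).
    by rewrite modulus_sq ReM ReJ ImJ; ring.
  rewrite /g rmorph_sum /= mulr_suml Re_sum; apply: eq_bigr => i _.
  rewrite mulr_sumr Re_sum; apply: eq_bigr => j _.
  rewrite !rescaled_sampling_entry rmorphM /= !conjCK.
  set p1 := phi i (tau k w); set p2 := phi i (tau l w).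
  set p3 := phi j (tau k w); set p4 := phi j (tau l w).
  rewrite (_ : _ * _ * (_ * _) = (p1 * p3^*) * (p2 * p4^*)^*).
    by rewrite ReM ReJ ImJ /gram_re /gram_im -/p1 -/p2 -/p3 -/p4; ring.
  by rewrite rmorphM /= conjCK; ring.
have bgr := bounded_measurable_gram_re; have bgi := bounded_measurable_gram_im.
have b1 i j : bounded_measurable (fun w => gram_re i j (tau k w) * gram_re i j (tau l w)).
  by apply: bounded_measurableM; exact: bounded_measurable_comp.
have b2 i j : bounded_measurable (fun w => gram_im i j (tau k w) * gram_im i j (tau l w)).
  by apply: bounded_measurableM; exact: bounded_measurable_comp.
split.
  apply: bounded_measurable_sum => i; apply: bounded_measurable_sum => j.
  exact: bounded_measurableD.
rewrite (positive_linear_sum (mean_positive_linear P)); last first.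
  by move=> i; apply: bounded_measurable_sum => j; exact: bounded_measurableD.
rewrite -[X in _ = X%:R]card_ord -sumr_const; apply: eq_bigr => i _.
rewrite (positive_linear_sum (mean_positive_linear P)); last first.
  by move=> j; exact: bounded_measurableD.
rewrite (bigD1 i) //= big1 => [|j ji].
  by rewrite D // !(mean_sample_pair iid) // !mean_gram_re mean_gram_im eqxx mul0r !addr0 mulr1.
rewrite D // !(mean_sample_pair iid) // !mean_gram_re mean_gram_im eq_sym (negbTE ji).
by rewrite !mul0r addr0.
Qed.

Lemma offdiagonal_likely :
  likely P (16 * (m%:R ^+ 2 / N%:R)) (fun w =>
    \sum_(k < m) \sum_(l < m | l != k)
      modulus (\sum_j (B w j k)^* * B w j l) ^+ 2 <= (N%:R / 4) ^+ 2).
Proof.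
have N0' : 0 < N%:R :> R by rewrite ltr0n.
have bm k : bounded_measurable (fun w => \sum_(l < m | l != k)
      modulus (\sum_j (B w j k)^* * B w j l) ^+ 2).
  under [X in bounded_measurable X]funext do rewrite big_mkcond.
  apply: bounded_measurable_sum => l; case lk: (l != k).
    by rewrite eq_sym in lk; case: (mean_offdiagonal lk).
  exact: bounded_measurable_cst.
have hmean : mean P (fun w => \sum_(k < m) \sum_(l < m | l != k)
      modulus (\sum_j (B w j k)^* * B w j l) ^+ 2) <= m%:R ^+ 2 * N%:R.
  rewrite (positive_linear_sum (mean_positive_linear P)) //.
  apply: (@le_trans _ _ (\sum_(k < m) m%:R * N%:R)); last first.
    by rewrite sumr_const card_ord -[_ *+ m]mulr_natl expr2 mulrA.
  apply: ler_sum => k _.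
  under [X in mean P X]funext do rewrite big_mkcond.
  rewrite (positive_linear_sum (mean_positive_linear P)) => [|l]; last first.
    case lk: (l != k); last exact: bounded_measurable_cst.
    by rewrite eq_sym in lk; case: (mean_offdiagonal lk).
  apply: (@le_trans _ _ (\sum_(l < m) N%:R)); last first.
    by rewrite sumr_const card_ord -[_ *+ m]mulr_natl.
  apply: ler_sum => l _; case lk: (l != k).
    by rewrite eq_sym in lk; case: (mean_offdiagonal lk) => _ ->.
  by rewrite (positive_linear0 (mean_positive_linear P)).
have bX := bounded_measurable_sum (index_enum 'I_m) bm.
have X0 w : 0 <= \sum_(k < m) \sum_(l < m | l != k)
      modulus (\sum_j (B w j k)^* * B w j l) ^+ 2.
  by apply: sumr_ge0 => k _; apply: sumr_ge0 => l _; exact: sqr_ge0.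
have a0 : 0 < (N%:R / 4 : R) ^+ 2 by rewrite exprn_gt0 // divr_gt0.
have := markov_likely bX X0 a0 hmean.
apply: likely_mono => [|w /ltW //].
by rewrite le_eqVlt; apply/orP; left; apply/eqP; field; rewrite gt_eqF.
Qed.

Lemma adjoint_lower_bound w :
  (forall k, 3 * (N%:R / 4) <= l2norm (col k (B w)) ^+ 2) ->
  \sum_(k < m) \sum_(l < m | l != k)
      modulus (\sum_j (B w j k)^* * B w j l) ^+ 2 <= (N%:R / 4) ^+ 2 ->
  forall u : 'cV[R[i]]_m,
    N%:R / (2 * m%:R) * l2norm u ^+ 2 <= l2norm ((A w)^t* *m u) ^+ 2.
Proof.
move=> hd ho u.
have a0 : 0 <= N%:R / 4 :> R by rewrite divr_ge0.
have m0' : 0 < m%:R :> R by rewrite ltr0n.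
have := gram_lower_bound a0 hd ho u.
rewrite /B -scalemxAl l2normZ exprMn real_normK ?num_real // (sqr_sqrtr (ler0n R m)).
move=> h.
have -> : N%:R / (2 * m%:R) * l2norm u ^+ 2 = (2 * (N%:R / 4) * l2norm u ^+ 2) / m%:R.
  by field; rewrite gt_eqF.
by rewrite ler_pdivrMr // [leRHS]mulrC.
Qed.

Lemma sampling_energy w v :
  l2norm (A w *m v) ^+ 2 =
  empirical_mean (fun k => tau k w) (fun t => complex.Re (synthesis v t) ^+ 2) +
  empirical_mean (fun k => tau k w) (fun t => complex.Im (synthesis v t) ^+ 2).
Proof.
rewrite l2norm_sq /empirical_mean -mulrDr -big_split mulr_sumr.
apply: eq_bigr => k _; rewrite mxE.
have -> : \sum_j A w k j * v j 0 = ((Num.sqrt m%:R)^-1)%:C%C * synthesis v (tau k w).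
  by rewrite /synthesis mulr_sumr; apply: eq_bigr => j _; rewrite mxE mulrA.
rewrite modulusM modulus_real exprMn real_normK ?num_real // exprVn.
by rewrite (sqr_sqrtr (ler0n R m)) modulus_sq.
Qed.

End Sampling.

End BOS.

(** * Robust recovery with high probability, and the choice of the nets *)

Section RecoveryLikely.
Context {R : realType} {d d' : measure_display}.
Context {T : measurableType d} {Omega : measurableType d'}.
Variables (nu : probability T R) (N : nat) (phi : 'I_N -> T -> R[i]) (K : R).
Hypothesis bos : bounded_orthonormal_system nu phi K.
Variables (P : probability Omega R) (m : nat) (tau : 'I_m -> {RV P >-> T}).
Hypothesis iid : iid_samples nu tau.
Hypothesis m0 : (0 < m)%N.
Hypothesis N0 : (0 < N)%N.
Hypothesis K0 : 0 < K.
Variable s : nat.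
Hypothesis s0 : (0 < s)%N.

Let A w := sampling_matrix phi (fun k => tau k w).

(** A complex combination of the phi_j has as real and imaginary parts two real
combinations of the 2N functions Re phi_j, Im phi_j, whose coefficients have l1
norm at most 2 |v|_1. The lower bound for the hull is used for both, and the
truncation losses leave at least 1/256 of the energy 1. *)
Lemma cone_likely (l : nat) (q : nat -> nat) (delta : nat -> R) :
  8 * Num.sqrt s%:R * K <= 2 * level 4^-1 l ->
  (forall i : 'I_l, [/\ (0 < q i)%N, level 4^-1 i <= 8 * (8 * Num.sqrt s%:R * K) &
    4 * expR (- ((q i)%:R * (level 4^-1 i / 2) ^+ 2 /
      (32 * (8 * Num.sqrt s%:R * K) ^+ 2))) <= delta i]) ->
  \sum_(i < l) level 4^-1 i ^+ 2 * (delta i + delta i) <= 256^-1 ->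
  likely P (\sum_(i < l) (4 * N%:R) ^+ q i * expR (- (m%:R * delta i)))
    (fun w => forall v : 'cV[R[i]]_N,
       l1norm v <= 4 * Num.sqrt s%:R * l2norm v ->
       16^-1 * l2norm v <= l2norm (A w *m v)).
Proof.
move=> hl hq hd.
have sq0 : 0 < Num.sqrt s%:R :> R by rewrite sqrtr_gt0 ltr0n.
pose F (a : 'I_N * bool) t := if a.2 then complex.Im (phi a.1 t) else complex.Re (phi a.1 t).
have bmF a : bounded_measurable (F a).
  rewrite /F; case: a.2.
    exact: bos_bounded_measurable_Im bos _.
  exact: bos_bounded_measurable_Re bos _.
have FK a t : `|F a t| <= K.
  apply: le_trans (bos_modulus_le bos a.1 t); rewrite /F; case: a.2.
    exact: normr_Im_le_modulus.
  exact: normr_Re_le_modulus.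
have J0 : (0 < #|{: 'I_N * bool}|)%N by rewrite card_prod card_ord card_bool muln_gt0 N0.
have M0 : 0 < 8 * Num.sqrt s%:R :> R by rewrite mulr_gt0.
have t00 : 0 < 4^-1 :> R by rewrite invr_gt0.
have := symmetric_hull_lower_bound iid m0 J0 bmF FK K0 M0 t00 hl hq.
have -> : 2 * #|{: 'I_N * bool}|%:R = 4 * N%:R :> R.
  by rewrite card_prod card_ord card_bool natrM; ring.
apply: likely_mono => // w hw.
have sumF (c : 'I_N * bool -> R) :
    \sum_a c a = \sum_j (c (j, true) + c (j, false)).
  rewrite (eq_bigr (fun a => c (a.1, a.2))) => [|[]//].
  rewrite -(pair_bigA _ (fun j b => c (j, b))) /=.
  by apply: eq_bigr => j _; rewrite big_bool.
have unit_case v : l2norm v = 1 -> l1norm v <= 4 * Num.sqrt s%:R ->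
    16^-1 <= l2norm (A w *m v).
  move=> v1 vs.
  pose cre (a : 'I_N * bool) : R :=
    if a.2 then - complex.Im (v a.1 0) else complex.Re (v a.1 0).
  pose cim (a : 'I_N * bool) : R :=
    if a.2 then complex.Re (v a.1 0) else complex.Im (v a.1 0).
  have bre : \sum_a `|cre a| <= 8 * Num.sqrt s%:R.
    rewrite sumF; apply: (@le_trans _ _ (\sum_j 2 * modulus (v j 0))).
      apply: ler_sum => j _; rewrite /cre /= normrN addrC.
      exact: normr_Re_Im_le_modulus.
    by rewrite -mulr_sumr; move: vs; rewrite /l1norm; lra.
  have bim : \sum_a `|cim a| <= 8 * Num.sqrt s%:R.
    rewrite sumF; apply: (@le_trans _ _ (\sum_j 2 * modulus (v j 0))).
      by apply: ler_sum => j _; rewrite /cim /=; exact: normr_Re_Im_le_modulus.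
    by rewrite -mulr_sumr; move: vs; rewrite /l1norm; lra.
  have ere : (fun t => (\sum_a cre a * F a t) ^+ 2) =
      (fun t => complex.Re (synthesis phi v t) ^+ 2).
    apply/funext => t; congr (_ ^+ 2); rewrite sumF /synthesis Re_sum.
    by apply: eq_bigr => j _; rewrite /cre /F /= ReM; ring.
  have eim : (fun t => (\sum_a cim a * F a t) ^+ 2) =
      (fun t => complex.Im (synthesis phi v t) ^+ 2).
    apply/funext => t; congr (_ ^+ 2); rewrite sumF /synthesis Im_sum.
    by apply: eq_bigr => j _; rewrite /cim /F /= ImM; ring.
  have h1 := hw cre bre; have h2 := hw cim bim.
  rewrite ere in h1; rewrite eim in h2.
  have iso := mean_synthesis_sq bos v; rewrite v1 expr1n in iso.
  have energy := sampling_energy phi tau w v.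
  rewrite -ler_sqr ?nnegrE ?l2norm_ge0 // energy.
  by lra.
move=> v hv; have [v0|v0] := eqVneq (l2norm v) 0.
  by rewrite v0 mulr0 l2norm_ge0.
have vp : 0 < l2norm v by rewrite lt_def v0 l2norm_ge0.
pose a := (l2norm v)^-1; have a0 : 0 < a by rewrite invr_gt0.
have := unit_case (a%:C%C *: v).
rewrite -scalemxAr !l2normZ gtr0_norm // mulVf // => /(_ erefl).
have -> : l1norm (a%:C%C *: v) = a * l1norm v.
  rewrite /l1norm mulr_sumr; apply: eq_bigr => i _.
  by rewrite mxE modulusM modulus_real gtr0_norm.
rewrite /a ler_pdivrMl // ler_pdivlMl //.
have -> : l2norm v * (4 * Num.sqrt s%:R) = 4 * Num.sqrt s%:R * l2norm v by ring.
by move=> /(_ hv); rewrite mulrC.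
Qed.

Lemma bos_recovery_likely (l : nat) (q : nat -> nat) (delta : nat -> R) (xi : R) :
  8 * Num.sqrt s%:R * K <= 2 * level 4^-1 l ->
  (forall i : 'I_l, [/\ (0 < q i)%N, level 4^-1 i <= 8 * (8 * Num.sqrt s%:R * K) &
    4 * expR (- ((q i)%:R * (level 4^-1 i / 2) ^+ 2 /
      (32 * (8 * Num.sqrt s%:R * K) ^+ 2))) <= delta i]) ->
  \sum_(i < l) level 4^-1 i ^+ 2 * (delta i + delta i) <= 256^-1 ->
  (bos_distortion phi tau <= xi%:E)%E ->
  likely P (\sum_(i < l) (4 * N%:R) ^+ q i * expR (- (m%:R * delta i)) +
            (4 * xi + 16 * (m%:R ^+ 2 / N%:R)))
    (fun w => forall (x xhat : 'cV[R[i]]_N) (n : 'cV[R[i]]_m) (eta : R), 0 <= eta ->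
       qcbp_minimizer (A w) (A w *m x + n) eta xhat ->
       l2norm (xhat - x) <= best_approx_l1 s x / Num.sqrt s%:R + 32 * eta +
         (Num.sqrt N%:R / Num.sqrt s%:R + 1) / Num.sqrt (N%:R / (2 * m%:R)) *
         Num.max (l2norm n - eta) 0).
Proof.
move=> hl hq hd hxi.
have hcone := cone_likely hl hq hd.
have hdiag := diagonal_likely bos m0 N0 hxi.
have hoff := offdiagonal_likely bos iid m0 N0.
have := likely_and hcone (likely_and hdiag hoff).
apply: likely_mono => // w [cone [diag off]] x xhat n eta eta0 hmin.
have adj := adjoint_lower_bound m0 diag off.
have k0 : 0 < 16^-1 :> R by rewrite invr_gt0.
have g0 : 0 < N%:R / (2 * m%:R) :> R by rewrite divr_gt0 ?mulr_gt0 ?ltr0n.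
have := qcbp_robust s0 k0 g0 cone adj eta0 hmin.
by rewrite (_ : 2 / 16^-1 = 32 :> R) //; field.
Qed.

End RecoveryLikely.

Section NetParameters.
Context {R : realType}.

Lemma level_quarter_lt (B : R) (l i : nat) : 2 ^+ l.-1 < 2 * B -> (i < l)%N ->
  level 4^-1 i <= B / 2.
Proof.
move=> hl il; rewrite /level.
have : (2 ^+ i : R) <= 2 ^+ l.-1.
  by rewrite ler_weXn2l ?ler1n // -ltnS prednK // (leq_ltn_trans _ il).
by lra.
Qed.

(** The additive losses are delta_i = 1 / (512 l t_i^2), so that the total
weighted loss over the [l] levels is 1/256. Maurey's error is below delta_i for
q_i ~ 128 (B / t_i)^2 ln (2048 l B^2) draws, and in q_i ln n <= M delta_i the
factors t_i^2 cancel. *)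
Lemma net_parameters (B Y eps n M : R) (l : nat) :
  0 < eps -> 0 < B -> (0 < l)%N -> 2 ^+ l.-1 < 2 * B -> 2 * B <= 2 ^+ l ->
  0 < n -> ln n <= Y -> ln (l%:R / eps) <= Y -> 0 <= Y ->
  1 <= ln (2048 * l%:R * B ^+ 2) ->
  512 * 130 * l%:R * B ^+ 2 * ln (2048 * l%:R * B ^+ 2) * Y <= M ->
  exists (q : nat -> nat) (delta : nat -> R),
  [/\ B <= 2 * level 4^-1 l,
      forall i : 'I_l, [/\ (0 < q i)%N, level 4^-1 i <= 8 * B &
        4 * expR (- ((q i)%:R * (level 4^-1 i / 2) ^+ 2 / (32 * B ^+ 2))) <= delta i],
      \sum_(i < l) level 4^-1 i ^+ 2 * (delta i + delta i) <= 256^-1 &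
      \sum_(i < l) n ^+ q i * expR (- (M * delta i)) <= eps].
Proof.
move=> e0 B0 l0 lB Bl n0 nY lY Y0; set Lam := ln _ => Lam1 hM.
have l0' : 0 < l%:R :> R by rewrite ltr0n.
have l512 : 0 < 512 * l%:R :> R by apply: mulr_gt0 l0'; rewrite ltr0n.
pose t i : R := level 4^-1 i.
have t0 i : 0 < t i by rewrite /t mulr_gt0 // exprn_gt0.
pose delta i : R := (512 * l%:R * t i ^+ 2)^-1.
pose r i : R := 128 * B ^+ 2 / t i ^+ 2 * Lam.
have r0 i : 0 < r i.
  by rewrite mulr_gt0 ?divr_gt0 ?mulr_gt0 ?exprn_gt0 // (lt_le_trans ltr01).
(* r i >= Lam > 0, so rounding up costs at most one draw and keeps q i > 0 *)
pose q i : nat := `|Num.ceil (r i)|%N.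
have qE i : (q i)%:R = (Num.ceil (r i))%:~R :> R.
  by rewrite /q natr_absz gtr0_norm // ceil_gt0.
have rq i : r i <= (q i)%:R by rewrite qE; exact: ceil_ge.
have qr i : (q i)%:R <= r i + 1.
  by rewrite qE; have := ceilB1_lt (r i); rewrite intrB; lra.
have tB (i : 'I_l) : t i <= B / 2 by exact: level_quarter_lt lB (ltn_ord i).
have tB2 (i : 'I_l) : t i ^+ 2 <= B ^+ 2.
  by rewrite lerXn2r ?nnegrE ?(ltW (t0 i)) ?(ltW B0) //; have := tB i; lra.
exists q, delta; split.
- by rewrite /level; lra.
- move=> i; split.
  + by rewrite -(ltr0n R); exact: lt_le_trans (r0 i) (rq i).
  + by have := tB i; rewrite /t; lra.
  + have h1 : Lam <= (q i)%:R * (level 4^-1 i / 2) ^+ 2 / (32 * B ^+ 2).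
      rewrite ler_pdivlMr ?mulr_gt0 ?exprn_gt0 //.
      have := ler_wpM2r (ltW (exprn_gt0 2 (t0 i))) (rq i).
      rewrite /r mulrAC divfK; last by rewrite gt_eqF // exprn_gt0.
      by rewrite -/(t i); lra.
    apply: (@le_trans _ _ (4 * expR (- Lam))).
      by rewrite ler_wpM2l // ler_expR lerN2.
    have lB0 : 0 < l%:R * B ^+ 2 by rewrite mulr_gt0 // exprn_gt0.
    have lt0 : 0 < l%:R * t i ^+ 2 by rewrite mulr_gt0 // exprn_gt0.
    have -> : expR (- Lam) = (2048 * (l%:R * B ^+ 2))^-1.
      have aux (c : R) : 0 < c ->
          expR (- ln (c * l%:R * B ^+ 2)) = (c * (l%:R * B ^+ 2))^-1.
        by move=> c0; rewrite expRN -mulrA lnK // posrE mulr_gt0.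
      by apply: aux; rewrite ltr0n.
    rewrite /delta -[512 * _ * _]mulrA.
    have aux (c c' x y : R) : c' = 4 * c -> 0 < c -> 0 < x -> x <= y ->
        4 * (c' * y)^-1 <= (c * x)^-1.
      move=> -> c0 x0 xy; have y0 : 0 < y by exact: lt_le_trans xy.
      have -> : 4 * (4 * c * y)^-1 = (c * y)^-1 by field; rewrite !gt_eqF.
      by rewrite lef_pV2 ?posrE ?mulr_gt0 // ler_wpM2l // ltW.
    apply: aux lt0 _; [by ring | by rewrite ltr0n | by rewrite ler_wpM2l // ltW].
- have -> : \sum_(i < l) level 4^-1 i ^+ 2 * (delta i + delta i) =
      \sum_(i < l) (256 * l%:R)^-1.
    apply: eq_bigr => i _; rewrite /delta -/(t i); field.
    by rewrite !gt_eqF.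
  by rewrite sumr_const card_ord -[leLHS]mulr_natl invfM mulrCA divff ?mulr1 // gt_eqF.
- have step (i : 'I_l) : n ^+ q i * expR (- (M * delta i)) <= eps / l%:R.
    rewrite -[n in n ^+ _]lnK ?posrE // -expRM_natl -expRD.
    have -> : eps / l%:R = expR (- ln (l%:R / eps)).
      by rewrite expRN lnK ?posrE ?divr_gt0 // invf_div.
    rewrite ler_expR lerNr opprD opprK.
    have h1 : (q i)%:R * ln n <= (r i + 1) * Y.
      apply: (@le_trans _ _ ((q i)%:R * Y)); first by rewrite ler_wpM2l.
      by rewrite ler_wpM2r.
    have h2 : (r i + 2) * Y <= M * delta i.
      rewrite /delta (ler_pdivlMr _ _ (mulr_gt0 l512 (exprn_gt0 2 (t0 i)))).
      apply: le_trans hM.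
      have -> : (r i + 2) * Y * (512 * l%:R * t i ^+ 2) =
          512 * l%:R * Y * (128 * B ^+ 2 * Lam + 2 * t i ^+ 2).
        by rewrite /r; field; rewrite gt_eqF.
      have -> : 512 * 130 * l%:R * B ^+ 2 * Lam * Y =
          512 * l%:R * Y * (130 * B ^+ 2 * Lam) by ring.
      apply: (ler_wpM2l (mulr_ge0 (ltW l512) Y0)).
      have := tB2 i; have : B ^+ 2 <= B ^+ 2 * Lam by rewrite ler_peMr ?sqr_ge0.
      by lra.
    by lra.
  apply: (le_trans (ler_sum _ (fun i _ => step i))).
  by rewrite sumr_const card_ord -[leLHS]mulr_natl mulrC divfK // gt_eqF.
Qed.

End NetParameters.

(** * Estimates on logarithms *)

Section Logarithms.
Context {R : realType}.

Lemma ln2_ge_half : 2^-1 <= ln 2 :> R.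
Proof.
rewrite -[leLHS]expRK ler_ln ?posrE ?expR_gt0 //.
have := @expR_le_quadratic R 2^-1 (lexx _); lra.
Qed.

Lemma ln_le_self (x : R) : 0 < x -> ln x <= x.
Proof. by move=> x0; apply/ltW/ln_sublinear. Qed.

Lemma ln_ge_half (n : nat) : (2 <= n)%N -> 2^-1 <= ln n%:R :> R.
Proof.
move=> n2; apply: (le_trans ln2_ge_half); rewrite ler_ln ?posrE ?ltr0n ?ler_nat //.
exact: leq_trans n2.
Qed.

Lemma dyadic_scale (x : R) : 1 < x ->
  exists l : nat, [/\ (0 < l)%N, 2 ^+ l.-1 < x & x <= 2 ^+ l].
Proof.
move=> x1; have x0 : 0 <= x by rewrite (le_trans _ (ltW x1)).
have ex : exists l : nat, x <= 2 ^+ l.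
  exists (Num.bound x); apply: (le_trans (ltW (archi_boundP x0))).
  by rewrite -natrX ler_nat ltnW // ltn_expl.
case: (ex_minnP ex) => l xl lmin; have l0 : (0 < l)%N.
  by rewrite lt0n; apply: contraL xl => /eqP ->; rewrite expr0 -ltNge.
exists l; split => //; rewrite ltNge; apply/negP => /lmin.
by rewrite leqNgt prednK // leqnn.
Qed.

Lemma dyadic_scale_log (x : R) (l : nat) : (0 < l)%N -> 2 ^+ l.-1 < x ->
  l%:R <= 1 + 2 * ln x /\ l%:R <= x.
Proof.
move=> l0 lx.
have x0 : 0 < x by rewrite (lt_trans _ lx) // exprn_gt0.
have lE : l%:R = 1 + l.-1%:R :> R by rewrite -[in LHS](prednK l0) -natr1 addrC.
split.
  have : ln (2 ^+ l.-1) <= ln x by rewrite ler_ln ?posrE ?exprn_gt0 // ltW.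
  rewrite lnXn // -[ln 2 *+ _]mulr_natr lE.
  have := ler_wpM2r (ler0n R l.-1) ln2_ge_half; lra.
apply: (le_trans _ (ltW lx)); rewrite -natrX ler_nat -[leqLHS](prednK l0).
exact: ltn_expl.
Qed.

(** With u = ln (max s 2) and k = ln (K^2), both the number of levels and the logarithm
in the number of draws are O(u + k). Their product is O(u^2 + k^2), where k^2 is
absorbed by W, the logarithm that remains in the oversampling factor. *)
Lemma net_size_bound (s l : nat) (K W : R) : (0 < s)%N -> 1 <= K ->
  (0 < l)%N -> 2 ^+ l.-1 < 2 * (8 * Num.sqrt s%:R * K) ->
  1 <= W -> ln (K ^+ 2) ^+ 2 <= W ->
  1 <= ln (2048 * l%:R * (8 * Num.sqrt s%:R * K) ^+ 2) /\
  l%:R * ln (2048 * l%:R * (8 * Num.sqrt s%:R * K) ^+ 2) <=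
    404 * ln (maxn s 2)%:R ^+ 2 * W.
Proof.
move=> s0 K1 l0 lB W1 kW.
have sR0 : 0 < s%:R :> R by rewrite ltr0n.
have s1 : 1 <= s%:R :> R by rewrite ler1n.
have K0 : 0 < K by lra.
set B := 8 * Num.sqrt s%:R * K in lB *.
have sq1 : 1 <= Num.sqrt s%:R :> R by rewrite -[leLHS]sqrtr1 ler_wsqrtr.
have B8 : 8 <= B by rewrite /B; nra.
have B0 : 0 < B by lra.
have [lb1 lb2] := dyadic_scale_log l0 lB.
set beta := ln (2 * B) in lb1.
set u := ln (maxn s 2)%:R; set k := ln (K ^+ 2) in kW *.
have k0 : 0 <= k by rewrite ln_ge0 // expr_ge1 // ltW.
have l2u : ln 2 <= u :> R by rewrite ler_ln ?posrE ?ltr0n ?leq_max ?orbT // ler_nat leq_max orbT.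
have lsu : ln s%:R <= u by rewrite ler_ln ?posrE ?ltr0n ?leq_max ?s0 // ler_nat leq_max leqnn.
have u2 : 2^-1 <= u by exact: le_trans ln2_ge_half l2u.
have ln2p n : ln (2 ^+ n) = n%:R * ln 2 :> R by rewrite lnXn // mulr_natl.
have BE : (2 * B) ^+ 2 = 2 ^+ 8 * (s%:R * K ^+ 2).
  by rewrite /B !exprMn sqr_sqrtr ?ltW //; ring.
have beta2 : ln ((2 * B) ^+ 2) = 2 * beta.
  have B20 : 0 < 2 * B by rewrite mulr_gt0.
  by rewrite lnXn // -[LHS]mulr_natl.
have betaE : 2 * beta = 8 * ln 2 + ln s%:R + k.
  rewrite -beta2.
  rewrite BE lnM ?posrE ?exprn_gt0 ?mulr_gt0 ?exprn_gt0 //.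
  by rewrite lnM ?posrE ?exprn_gt0 // ln2p addrA.
have LamE : ln (2048 * l%:R * B ^+ 2) = 9 * ln 2 + ln l%:R + 2 * beta.
  have p1 : (l%:R : R) \is Num.pos by rewrite posrE ltr0n.
  have p2 : (2 * B) ^+ 2 \is Num.pos by rewrite posrE exprn_gt0 // mulr_gt0.
  have p3 : (2 ^+ 9 : R) \is Num.pos by rewrite posrE exprn_gt0.
  rewrite -beta2 -(ln2p 9%N) -(lnM p3 p1) -lnM //; last first.
    by rewrite posrE mulr_gt0 // exprn_gt0.
  by congr ln; ring.
have lnl0 : 0 <= ln l%:R :> R by rewrite ln_ge0 // ler1n.
have lnl : ln l%:R <= beta by rewrite ler_ln ?posrE ?ltr0n // mulr_gt0.
have ln20 := ln2_ge_half.
rewrite LamE; split; first by have := ln_ge0 s1; lra.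
have hl : l%:R <= 11 * u + k by lra.
have hL : 9 * ln 2 + ln l%:R + 2 * beta <= 25 * u + 2 * k by lra.
apply: (@le_trans _ _ ((11 * u + k) * (25 * u + 2 * k))).
  apply: ler_pM => //.
  by have := ln_ge0 s1; lra.
have uk : 2 * (u * k) <= u ^+ 2 + k ^+ 2 by have := sqr_ge0 (u - k); nra.
have u24 : 4^-1 <= u ^+ 2 by nra.
have h1 : k ^+ 2 <= 4 * (u ^+ 2 * W) by nra.
have h2 : u ^+ 2 <= u ^+ 2 * W by rewrite ler_peMr // sqr_ge0.
by nra.
Qed.

Lemma log_factorE N s (eps K : R) : log_factor N s eps K =
  4 * K ^+ 2 * Num.max (ln s%:R ^+ 2 * ln (4 * K ^+ 2 * s%:R * ln N%:R) * ln N%:R)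
    (ln (1 / eps)).
Proof.
by rewrite /log_factor (_ : K ^+ 2 / 2^-1 ^+ 2 = 4 * K ^+ 2) //; field.
Qed.

Lemma inner_log_ge1 N s (K : R) : (2 <= N)%N -> (2 <= s)%N -> 1 <= K ->
  4 <= 4 * K ^+ 2 * s%:R * ln N%:R /\ 1 <= ln (4 * K ^+ 2 * s%:R * ln N%:R).
Proof.
move=> N2 s2 K1; have lnN := ln_ge_half N2.
have K2 : 1 <= K ^+ 2 by rewrite expr_ge1 //; lra.
have s2' : 2 <= s%:R :> R by rewrite ler_nat.
have h1 : 1 <= s%:R * ln N%:R :> R.
  apply: (@le_trans _ _ (2 * 2^-1)); first by rewrite divff.
  by apply: ler_pM; rewrite ?invr_ge0.
have h2 : 4 <= 4 * K ^+ 2 * s%:R * ln N%:R.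
  rewrite -[leRHS]mulrA -mulrA.
  have := ler_pM ler01 ler01 K2 h1; lra.
split => //; apply: (@le_trans _ _ (ln 4)); last by rewrite ler_ln ?posrE //; lra.
rewrite (_ : 4 = 2 ^+ 2 :> R); last by ring.
by rewrite lnXn // mulr2n; have := ln2_ge_half; lra.
Qed.

Lemma polylogarithmic_log_factor :
  polylogarithmic (fun N s (eps K : R) => log_factor N (maxn s 2) eps K).
Proof.
move=> eps K /andP[e0 e1] K1.
pose b := ln (1 / eps).
have b0 : 0 <= b by rewrite ln_ge0 // div1r invf_ge1 // ltW.
have K2 : 1 <= K ^+ 2 by rewrite expr_ge1 //; lra.
exists (4 * K ^+ 2 * (4 * K ^+ 2 + 2 + b)), 4%N => N s N0 s0.
set X := 1 + ln N%:R + ln s%:R.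
have lnN0 : 0 <= ln N%:R :> R by rewrite ln_ge0 // ler1n.
have lns0 : 0 <= ln s%:R :> R by rewrite ln_ge0 // ler1n.
have X1 : 1 <= X by rewrite /X; lra.
have s2 : (2 <= maxn s 2)%N by rewrite leq_max leqnn orbT.
rewrite log_factorE -/b; set sg := maxn s 2 in s2 *.
have lnsg : 0 <= (ln sg%:R : R) <= X.
  rewrite ln_ge0 ?ler1n ?(ltnW s2) //= /sg /maxn; case: ifP => _; last by rewrite /X; lra.
  have : ln 2 <= 1 :> R by have := @le_ln1Dx R 1; rewrite (_ : 1 + 1 = 2) //; apply; lra.
  by rewrite /X; lra.
move/andP: lnsg => [lnsg0 lnsgX].
set a := ln sg%:R ^+ 2 * _ * _.
have ha : 0 <= a <= (4 * K ^+ 2 + 2) * X ^+ 4.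
  have X40 : 0 <= (4 * K ^+ 2 + 2) * X ^+ 4 by rewrite mulr_ge0 ?exprn_ge0 //; lra.
  have [N1|N2] := leqP N 1.
    have -> : a = 0 by rewrite /a (_ : N = 1%N) ?ln1 ?mulr0 //; apply/eqP; rewrite eqn_leq N1.
    by rewrite lexx.
  have [h4 h1] := inner_log_ge1 N2 s2 K1.
  rewrite /a; set W := ln (4 * _ * _ * _) in h1 *.
  have lnN := ln_ge_half N2.
  have sg0 : 0 < sg%:R :> R by rewrite ltr0n (leq_trans _ s2).
  have K40 : 0 < 4 * K ^+ 2 by lra.
  have K0 : 0 < K by lra.
  have hW : W <= (4 * K ^+ 2 + 2) * X.
    rewrite /W lnM ?posrE ?mulr_gt0 //; last lra.
    rewrite lnM ?posrE //.
    have t1 := ln_le_self K40; have lnN' : 0 < ln N%:R :> R by lra.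
    have t2 := ln_le_self lnN'.
    have t3 : ln N%:R <= X by rewrite /X; lra.
    have t4 : 4 * K ^+ 2 <= 4 * K ^+ 2 * X by rewrite ler_peMr // ltW.
    by lra.
  have lNX : ln N%:R <= X by rewrite /X; lra.
  apply/andP; split.
    by rewrite !mulr_ge0 ?sqr_ge0 //; lra.
  rewrite (_ : (4 * K ^+ 2 + 2) * X ^+ 4 = X ^+ 2 * ((4 * K ^+ 2 + 2) * X) * X); last by ring.
  apply: ler_pM => //; first by rewrite mulr_ge0 ?sqr_ge0 //; lra.
  apply: ler_pM => //; rewrite ?sqr_ge0 //; first lra.
  by rewrite lerXn2r // nnegrE; lra.
move/andP: ha => [a0 aX].
have X4 : 1 <= X ^+ 4 by rewrite expr_ge1 //; lra.
have bX : b <= b * X ^+ 4 by rewrite ler_peMr.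
rewrite ger0_norm; last by rewrite mulr_ge0 ?le_max ?a0 //; lra.
rewrite -[leRHS]mulrA ler_wpM2l //; first lra.
by rewrite ge_max; apply/andP; split; nra.
Qed.

End Logarithms.

(** * Consequences of the sparsity condition *)

Section Regime.
Context {R : realType}.

(** The first term makes ln (ln N) exceed ln (K^2)^2, the second makes sqrt N
dominate s K^2, and the last two bound the two applications of Markov's
inequality by eps / 4 each. *)
Definition sparsity_constant (K D1 d : R) : R :=
  4 * expR (expR (ln (K ^+ 2) ^+ 2)) + 1024 * K ^+ 2 + 32 * D1 * d + 32 * d.

(** Everything follows from c s L sqrt (ln N) <= eps sqrt N, in which
L sqrt (ln N) >= 1/4, and from m <= 2 d s L. *)
Lemma sparsity_regime (N s m : nat) (eps K D1 L d : R) :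
  (2 <= N)%N -> (0 < s)%N -> 0 < eps -> eps < 1 -> 1 <= K -> 0 < D1 ->
  2 <= d -> 2^-1 <= L ->
  s%:R <= eps * Num.sqrt N%:R /
    (sparsity_constant K D1 d * L * Num.sqrt (ln N%:R)) ->
  m%:R <= d * s%:R * L + 1 ->
  [/\ expR (expR (ln (K ^+ 2) ^+ 2)) <= N%:R,
      256 * s%:R * K ^+ 2 <= Num.sqrt N%:R,
      eps^-1 <= Num.sqrt N%:R,
      4 * (D1 * Num.sqrt (m%:R ^+ 2 * ln m%:R / N%:R)) <= eps / 4 &
      16 * (m%:R ^+ 2 / N%:R) <= eps / 4].
Proof.
move=> N2 s0 e0 e1 K1 D10 d2 L2 hs hm.
have N1 : 1 <= N%:R :> R by rewrite ler1n ltnW.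
have N0 : 0 < N%:R :> R by lra.
have lnN := @ln_ge_half R _ N2.
have s1 : 1 <= s%:R :> R by rewrite ler1n.
set q := Num.sqrt N%:R in hs *; set w := Num.sqrt (ln N%:R) in hs.
set X := expR (expR _) in hs *.
have X0 : 0 < X by exact: expR_gt0.
have K2 : 1 <= K ^+ 2 by rewrite expr_ge1 //; lra.
have Dd0 : 0 < D1 * d by rewrite mulr_gt0 //; lra.
have cE : sparsity_constant K D1 d = 4 * X + 1024 * K ^+ 2 + 32 * (D1 * d) + 32 * d.
  by rewrite /sparsity_constant -/X mulrA.
set c := sparsity_constant _ _ _ in hs cE.
have c0 : 0 < c by lra.
have q1 : 1 <= q by rewrite -[leLHS]sqrtr1 ler_wsqrtr.
have q0 : 0 < q by lra.
have q2 : q ^+ 2 = N%:R by rewrite sqr_sqrtr // ltW.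
have qN : q <= N%:R by rewrite -q2 expr2 ler_peMl // ltW.
have w2 : w ^+ 2 = ln N%:R by rewrite sqr_sqrtr //; lra.
have wh : 2^-1 <= w.
  have w0 : 0 <= w by exact: sqrtr_ge0.
  rewrite leNgt; apply/negP => wl.
  have : w ^+ 2 < 2^-1 ^+ 2 by rewrite ltrXn2r ?nnegrE // invr_ge0.
  by rewrite w2; lra.
have x0 : 0 < c * L * w by rewrite !mulr_gt0 //; lra.
rewrite ler_pdivlMr // in hs.
pose y := L * w.
have y4 : 4^-1 <= y.
  have h : (2^-1 : R) * 2^-1 <= L * w by apply: ler_pM; rewrite ?invr_ge0.
  by rewrite /y; lra.
have hs' : c * (s%:R * y) <= eps * q.
  by apply: le_trans hs; rewrite /y le_eqVlt; apply/orP; left; apply/eqP; ring.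
have sy : s%:R <= 4 * (s%:R * y).
  have h : s%:R * 4^-1 <= s%:R * y by rewrite ler_wpM2l // ler0n.
  by lra.
have sy0 : 0 < s%:R * y by lra.
have eq : eps * q <= q by rewrite ler_piMl // ltW.
have cs : c * s%:R <= 4 * (eps * q).
  have := ler_wpM2l (ltW c0) sy; lra.
have c1 : c <= 4 * (eps * q).
  by apply: le_trans cs; rewrite ler_peMr // ltW.
have mw : m%:R * w <= 2 * d * (s%:R * y).
  (* the unit lost in rounding up is absorbed by d s L >= 1 *)
  have dsL : 1 <= d * s%:R * L.
    have h1 : (1 : R) * 2^-1 <= s%:R * L by apply: ler_pM; rewrite ?invr_ge0.
    have h2 : 2 * (1 * 2^-1) <= d * (s%:R * L) by apply: ler_pM => //; lra.
    by rewrite -mulrA; lra.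
  have : m%:R * w <= (2 * (d * s%:R * L)) * w.
    by rewrite ler_wpM2r //; lra.
  by rewrite /y; lra.
have mwc : c * (m%:R * w) <= 2 * d * (eps * q).
  apply: (@le_trans _ _ (c * (2 * d * (s%:R * y)))); first by rewrite ler_wpM2l // ltW.
  have -> : c * (2 * d * (s%:R * y)) = 2 * d * (c * (s%:R * y)) by ring.
  by rewrite ler_wpM2l //; lra.
have c32 : 32 * d <= c by lra.
have m0 : 0 <= m%:R :> R by exact: ler0n.
have mw0 : 0 <= m%:R * w by rewrite mulr_ge0 //; lra.
have mw16 : 16 * (m%:R * w) <= eps * q.
  have h : 32 * d * (m%:R * w) <= 2 * d * (eps * q).
    by apply: le_trans mwc; rewrite ler_wpM2r.
  rewrite -(ler_pM2l (_ : 0 < 2 * d)); last lra.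
  by lra.
have mq : 8 * m%:R <= eps * q.
  have : m%:R * 2^-1 <= m%:R * w by rewrite ler_wpM2l.
  by lra.
have mN : m%:R <= N%:R :> R by lra.
split.
- by lra.
- have h : 1024 * K ^+ 2 * s%:R <= c * s%:R by rewrite ler_wpM2r //; lra.
  by lra.
- rewrite -[leLHS]mul1r ler_pdivrMr // mulrC; lra.
- have h1 : Num.sqrt (m%:R ^+ 2 * ln m%:R / N%:R) <= m%:R * w / q.
    have -> : m%:R * w / q = Num.sqrt ((m%:R * w / q) ^+ 2).
      by rewrite sqrtr_sqr ger0_norm // divr_ge0 // ltW.
    rewrite ler_wsqrtr // !exprMn exprVn q2 w2 ler_wpM2r ?invr_ge0 ?(ltW N0) //.
    rewrite ler_wpM2l ?sqr_ge0 //.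
    have [->|mp] := posnP m; first by rewrite ln0 //; lra.
    by rewrite ler_ln ?posrE // ltr0n.
  have h2 : 32 * (D1 * d) * (m%:R * w) <= 2 * d * (eps * q).
    by apply: le_trans mwc; rewrite ler_wpM2r //; lra.
  have h3 : 16 * D1 * (m%:R * w) <= eps * q.
    rewrite -(ler_pM2l (_ : 0 < 2 * d)); last lra.
    by lra.
  have h4 : 16 * D1 * (m%:R * w / q) <= eps by rewrite mulrA ler_pdivrMr.
  have := ler_wpM2l (ltW D10) h1; lra.
- have h1 : (8 * m%:R) ^+ 2 <= (eps * q) ^+ 2.
    have p1 : 0 <= 8 * m%:R :> R by lra.
    have p2 : 0 <= eps * q by rewrite mulr_ge0 // ltW.
    by rewrite lerXn2r ?nnegrE.
  have h2 : 64 * (m%:R ^+ 2 / N%:R) <= eps ^+ 2.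
    rewrite mulrA ler_pdivrMr // -q2 -exprMn; apply: le_trans h1.
    by rewrite exprMn; lra.
  have h3 : eps ^+ 2 <= eps by rewrite expr2 ler_piMl // ltW.
  by lra.
Qed.

End Regime.

(** * The recovery theorem *)

Section Assembly.
Context {R : realType}.

(** The product of the constants lost in the choice of the nets (512 * 130), in
B^2 = 64 s K^2, and in [net_size_bound] (404). *)
Definition oversampling : R := 512 * 130 * (64 * 404).

Lemma oversampling_ge2 : 2 <= oversampling.
Proof. by rewrite /oversampling; lra. Qed.

Lemma net_condition (N s l : nat) (K L M : R) :
  (2 <= N)%N -> (0 < s)%N -> 1 <= K ->
  expR (expR (ln (K ^+ 2) ^+ 2)) <= N%:R ->
  (0 < l)%N -> 2 ^+ l.-1 < 2 * (8 * Num.sqrt s%:R * K) ->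
  4 * K ^+ 2 * (ln (maxn s 2)%:R ^+ 2 *
    ln (4 * K ^+ 2 * (maxn s 2)%:R * ln N%:R) * ln N%:R) <= L ->
  oversampling * s%:R * L <= M ->
  1 <= ln (2048 * l%:R * (8 * Num.sqrt s%:R * K) ^+ 2) /\
  512 * 130 * l%:R * (8 * Num.sqrt s%:R * K) ^+ 2 *
    ln (2048 * l%:R * (8 * Num.sqrt s%:R * K) ^+ 2) * (4 * ln N%:R) <= M.
Proof.
move=> N2 s0 K1 hN l0 lB hL hM.
have s2 : (2 <= maxn s 2)%N by rewrite leq_max leqnn orbT.
have [h4 W1] := inner_log_ge1 N2 s2 K1.
set W := ln (4 * _ * _ * _) in W1 hL.
have lnN := @ln_ge_half R _ N2.
have K0 : 0 < K by lra.
have K2 : 1 <= K ^+ 2 by rewrite expr_ge1 //; lra.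
have kW : ln (K ^+ 2) ^+ 2 <= W.
  have e1 : expR (ln (K ^+ 2) ^+ 2) <= ln N%:R.
    rewrite -[leLHS]expRK ler_ln ?posrE ?expR_gt0 // ltr0n.
    exact: leq_trans N2.
  have lnN0 : 0 < ln N%:R :> R by lra.
  apply: (@le_trans _ _ (ln (ln N%:R))).
    by rewrite -[leLHS]expRK ler_ln ?posrE ?expR_gt0.
  rewrite ler_ln ?posrE //; last by lra.
  rewrite ler_peMl ?(ltW lnN0) //.
  have : (1 : R) * 1 <= K ^+ 2 * (maxn s 2)%:R.
    by apply: ler_pM => //; rewrite ler1n (leq_trans _ s2).
  by rewrite -mulrA; lra.
have [Lam1 hLam] := net_size_bound s0 K1 l0 lB W1 kW.
split => //; apply: le_trans hM.
have -> : (8 * Num.sqrt s%:R * K) ^+ 2 = 64 * (s%:R * K ^+ 2).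
  by rewrite !exprMn sqr_sqrtr ?ler0n //; ring.
move: hLam; have -> : (8 * Num.sqrt s%:R * K) ^+ 2 = 64 * (s%:R * K ^+ 2).
  by rewrite !exprMn sqr_sqrtr ?ler0n //; ring.
set Lam := ln (2048 * _ * _) => hLam.
set u := ln (maxn s 2)%:R in hLam hL.
have sK0 : 0 <= 4 * (s%:R * K ^+ 2 * ln N%:R).
  by rewrite !mulr_ge0 // ?sqr_ge0 //; lra.
have h1 := ler_wpM2l sK0 hLam.
have h2 := ler_wpM2l (ler0n R s) hL.
have c0 : 0 <= 512 * 130 * 64 :> R by lra.
have h3 := ler_wpM2l c0 h1.
have o0 : 0 <= oversampling by have := oversampling_ge2; lra.
have h4' := ler_wpM2l o0 h2.
rewrite /oversampling in h4' *.
have -> : 512 * 130 * l%:R * (64 * (s%:R * K ^+ 2)) * Lam * (4 * ln N%:R) =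
    512 * 130 * 64 * (4 * (s%:R * K ^+ 2 * ln N%:R) * (l%:R * Lam)) by ring.
apply: (le_trans h3).
have -> : 512 * 130 * 64 * (4 * (s%:R * K ^+ 2 * ln N%:R) * (404 * u ^+ 2 * W)) =
   512 * 130 * (64 * 404) * (s%:R * (4 * K ^+ 2 * (u ^+ 2 * W * ln N%:R))) by ring.
by rewrite -[leRHS]mulrA.
Qed.

(** The number of levels and 1 / eps are both at most sqrt N. *)
Lemma ln_terms (N l s : nat) (K eps : R) :
  (2 <= N)%N -> 0 < eps -> (0 < s)%N -> 1 <= K ->
  256 * s%:R * K ^+ 2 <= Num.sqrt N%:R -> eps^-1 <= Num.sqrt N%:R ->
  l%:R <= 2 * (8 * Num.sqrt s%:R * K) -> (0 < l)%N ->
  ln (4 * N%:R) <= 4 * ln N%:R :> R /\ ln (l%:R / (eps / 4)) <= 4 * ln N%:R.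
Proof.
move=> N2 e0 s0 K1 hs he hl l0.
have N0 : 0 < N%:R :> R by rewrite ltr0n (leq_trans _ N2).
have l0' : 0 < l%:R :> R by rewrite ltr0n.
set q := Num.sqrt N%:R in hs he.
have q2 : q ^+ 2 = N%:R by rewrite sqr_sqrtr // ltW.
have ln2N : ln 2 <= ln N%:R :> R by rewrite ler_ln ?posrE // ler_nat.
have ln4 : ln 4 = 2 * ln 2 :> R.
  by rewrite (_ : 4 = 2 ^+ 2 :> R) ?lnXn // ?mulr_natl //; ring.
have lnN := @ln_ge_half R _ N2.
split; first by rewrite lnM ?posrE // ln4; lra.
have s1 : 1 <= s%:R :> R by rewrite ler1n.
have lq : l%:R <= q.
  apply: (le_trans hl); apply: le_trans hs.
  have h1 : Num.sqrt s%:R <= s%:R :> R.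
    have sq1 : 1 <= Num.sqrt s%:R :> R by rewrite -[leLHS]sqrtr1 ler_wsqrtr.
    by rewrite -[leRHS]sqr_sqrtr ?ler0n // expr2 ler_peMl // (le_trans ler01).
  have h2 : Num.sqrt s%:R * K <= s%:R * K ^+ 2.
    by apply: ler_pM => //; rewrite ?sqrtr_ge0 //; [lra | rewrite expr2 ler_peMl //; lra].
  have h3 : 0 <= s%:R * K ^+ 2 by rewrite mulr_ge0 ?sqr_ge0.
  have -> : 2 * (8 * Num.sqrt s%:R * K) = 16 * (Num.sqrt s%:R * K) by ring.
  by rewrite -mulrA; lra.
have h : l%:R / (eps / 4) <= 4 * N%:R.
  have -> : l%:R / (eps / 4) = 4 * (l%:R * eps^-1) by field; rewrite gt_eqF.
  rewrite ler_wpM2l // -q2 expr2; apply: ler_pM => //.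
  by rewrite invr_ge0 ltW.
apply: (@le_trans _ _ (ln (4 * N%:R))).
  have p1 : 0 < l%:R / (eps / 4) by rewrite divr_gt0 // divr_gt0.
  by rewrite ler_ln ?posrE // mulr_gt0.
by rewrite lnM ?posrE // ln4; lra.
Qed.

Lemma quotient_constant (N s m : nat) (L d : R) :
  (0 < s)%N -> (0 < m)%N -> (s <= N)%N -> 0 <= d -> 0 <= L ->
  m%:R <= 2 * (d * s%:R * L) ->
  (Num.sqrt N%:R / Num.sqrt s%:R + 1) / Num.sqrt (N%:R / (2 * m%:R)) <=
  4 * Num.sqrt d * Num.sqrt L.
Proof.
move=> s0 m0 sN d0 L0 hm.
have sR : 0 < s%:R :> R by rewrite ltr0n.
have mR : 0 < m%:R :> R by rewrite ltr0n.
have NR : 0 < N%:R :> R by rewrite ltr0n (leq_trans s0).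
have sq0 : 0 < Num.sqrt s%:R :> R by rewrite sqrtr_gt0.
have qN0 : 0 < Num.sqrt N%:R :> R by rewrite sqrtr_gt0.
have g0 : 0 < Num.sqrt (N%:R / (2 * m%:R)) :> R.
  by rewrite sqrtr_gt0 divr_gt0 // mulr_gt0.
have sqsN : Num.sqrt s%:R <= Num.sqrt N%:R :> R by rewrite ler_wsqrtr // ler_nat.
rewrite ler_pdivrMr //.
have h1 : Num.sqrt N%:R / Num.sqrt s%:R + 1 <= 2 * (Num.sqrt N%:R / Num.sqrt s%:R) :> R.
  have : 1 <= Num.sqrt N%:R / Num.sqrt s%:R :> R by rewrite ler_pdivlMr // mul1r.
  by lra.
apply: (le_trans h1).
have -> : 4 * Num.sqrt d * Num.sqrt L * Num.sqrt (N%:R / (2 * m%:R)) =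
    2 * Num.sqrt (4 * (d * L) * (N%:R / (2 * m%:R))).
  have dL4 : 0 <= 4 * (d * L) by rewrite !mulr_ge0.
  have sq4 : Num.sqrt 4 = 2 :> R.
    by rewrite (_ : 4 = 2 ^+ 2) ?sqrtr_sqr ?ger0_norm //; ring.
  rewrite (sqrtrM _ dL4) (sqrtrM _ (ler0n R 4)) (sqrtrM _ d0) sq4; ring.
rewrite ler_wpM2l // -[leLHS]ger0_norm ?divr_ge0 ?(ltW sq0) ?(ltW qN0) //.
rewrite -sqrtr_sqr ler_wsqrtr // exprMn exprVn !sqr_sqrtr ?ler0n //.
have -> : 4 * (d * L) * (N%:R / (2 * m%:R)) = N%:R * (2 * (d * L) / m%:R).
  by field; rewrite gt_eqF.
rewrite ler_wpM2l // ler_pdivlMr // mulrC ler_pdivrMr //.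
by lra.
Qed.

End Assembly.

Unset Implicit Arguments.

Theorem theorem6 (R : realType) :
  exists (d C D E : R) (L : nat -> nat -> R -> R -> R),
  [/\ 0 < d, 0 < C, 0 < D & 0 < E] /\
  polylogarithmic L /\
  (* the explicit formula; for s = 1 it would make the claim below false *)
  (forall (N s : nat) (eps K : R), (2 <= s)%N ->
     L N s eps K = log_factor N s eps K) /\
  forall K D1 D2 : R, 1 <= K -> 0 < D1 -> 0 < D2 ->
  exists c : R, 0 < c /\
  forall (N : nat) (eps : R), 0 < eps < 1 ->
  (* the domain: T is carried by iota onto a subset of R^p *)
  forall (p : nat) (dT : measure_display) (T : measurableType dT)
         (iota : T -> 'rV[R]_p), injective iota ->
  forall (nu : probability T R) (phi : 'I_N -> T -> R[i]),
    bounded_orthonormal_system nu phi K ->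
  forall s : nat, (1 <= s)%N ->
    s%:R <= eps * Num.sqrt N%:R / (c * L N s eps K * Num.sqrt (ln N%:R)) ->
  forall m : nat, m%:Z = Num.ceil (d * s%:R * L N s eps K) ->
  forall (dO : measure_display) (Omega : measurableType dO)
         (P : probability Omega R) (tau : 'I_m -> {RV P >-> T}),
    iid_samples nu tau ->
    (bos_distortion phi tau <=
       (Num.min (D1 * Num.sqrt (m%:R ^+ 2 * ln m%:R / N%:R)) D2)%:E)%E ->
  exists G : set Omega,
    [/\ measurable G, ((1 - eps)%:E <= P G)%E &
      forall w : Omega, G w ->
      let A := sampling_matrix phi (fun k => tau k w) in
      forall (x : 'cV[R[i]]_N) (n : 'cV[R[i]]_m) (eta : R), 0 <= eta ->
      let y := A *m x + n in
      forall xhat : 'cV[R[i]]_N, qcbp_minimizer A y eta xhat ->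
        l2norm (xhat - x) <=
          C / Num.sqrt s%:R * best_approx_l1 s x + D * eta +
          E * Num.sqrt (L N s eps K) * Num.max (l2norm n - eta) 0].
Proof.
have d2 := @oversampling_ge2 R; have d0 : 0 < @oversampling R by lra.
(* 32 = 2 / kappa for the lower bound kappa = 1/16 on the cone *)
exists oversampling, 1, 32, (4 * Num.sqrt oversampling),
  (fun N s eps K => log_factor N (maxn s 2) eps K).
split; first by split => //; rewrite ?mulr_gt0 ?sqrtr_gt0.
split; first exact: polylogarithmic_log_factor.
split; first by move=> N s eps K s2; rewrite (maxn_idPl s2).
move=> K D1 D2 K1 D10 D20; exists (sparsity_constant K D1 oversampling).
split.
  have h1 := expR_gt0 (expR (ln (K ^+ 2) ^+ 2)).
  have h2 := sqr_ge0 K; have h3 : 0 < D1 * oversampling by rewrite mulr_gt0.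
  by rewrite /sparsity_constant -[32 * D1 * _]mulrA; lra.
move=> N eps /andP[e0 e1] p dT T iota _ nu phi bos s s0 hs m hm dO Omega P tau iid hxi.
have sR : 0 < s%:R :> R by rewrite ltr0n.
(* for N <= 1 the bound on s is a quotient by 0, hence 0 *)
have N2 : (2 <= N)%N.
  rewrite leqNgt; apply/negP => N1.
  have lnN0 : ln N%:R = 0 :> R.
    move: N1; rewrite ltnS leq_eqVlt ltnS leqn0 => /orP[/eqP ->|/eqP ->].
      exact: ln1.
    by rewrite ln0.
  by move: hs; rewrite lnN0 sqrtr0 mulr0 invr0 mulr0 leNgt sR.
have N0 : (0 < N)%N by exact: leq_trans N2.
have K2 : 1 <= K ^+ 2 by rewrite expr_ge1 //; lra.
have s2 : (2 <= maxn s 2)%N by rewrite leq_max leqnn orbT.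
set L := log_factor N (maxn s 2) eps K in hs hm *.
have hL : 4 * K ^+ 2 * (ln (maxn s 2)%:R ^+ 2 *
    ln (4 * K ^+ 2 * (maxn s 2)%:R * ln N%:R) * ln N%:R) <= L.
  rewrite /L log_factorE; apply: ler_wpM2l; first by rewrite mulr_ge0 ?sqr_ge0.
  by rewrite le_max lexx.
have L2 : 2^-1 <= L.
  apply: le_trans hL.
  have [_ W1] := inner_log_ge1 N2 s2 K1.
  have u2 := @ln_ge_half R _ s2; have lnN := @ln_ge_half R _ N2.
  set W := ln (4 * _ * _ * _) in W1 *; set u := ln (maxn s 2)%:R in u2 *.
  have h1 : (2^-1 : R) ^+ 2 <= u ^+ 2 by rewrite lerXn2r ?nnegrE ?invr_ge0 //; lra.
  have h2 : (2^-1 : R) ^+ 2 * 1 <= u ^+ 2 * W by apply: ler_pM; rewrite ?exprn_ge0 ?invr_ge0.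
  have h3 : (2^-1 : R) ^+ 2 * 1 * 2^-1 <= u ^+ 2 * W * ln N%:R.
    by apply: ler_pM; rewrite ?mulr_ge0 ?exprn_ge0 ?invr_ge0.
  have h4 : (1 : R) * (2^-1 ^+ 2 * 1 * 2^-1) <= K ^+ 2 * (u ^+ 2 * W * ln N%:R).
    by apply: ler_pM; rewrite ?mulr_ge0 ?exprn_ge0 ?invr_ge0.
  by rewrite -[leRHS]mulrA; lra.
clearbody L.
have dsL : 1 <= oversampling * s%:R * L.
  have h1 : (1 : R) * 2^-1 <= s%:R * L by apply: ler_pM; rewrite ?invr_ge0 ?ler1n.
  have h2 : 2 * (1 * 2^-1) <= oversampling * (s%:R * L) by apply: ler_pM => //; lra.
  by rewrite -mulrA; lra.
have /andP[m1 m2] := ceil_itv (oversampling * s%:R * L).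
rewrite -hm intrB in m1; rewrite -hm in m2.
have {m1} hm1 : m%:R <= oversampling * s%:R * L + 1 :> R by rewrite -lerBlDr ltW.
have {m2} hm2 : oversampling * s%:R * L <= m%:R :> R by [].
have m0 : (0 < m)%N by rewrite -(ltr0n R); lra.
have [hN hs' he hxi4 hmN] := sparsity_regime N2 s0 e0 e1 K1 D10 d2 L2 hs hm1.
have K0 : 0 < K by lra.
have sq1 : 1 <= Num.sqrt s%:R :> R by rewrite -[leLHS]sqrtr1 ler_wsqrtr // ler1n.
pose B := 8 * Num.sqrt s%:R * K.
have sqK : (1 : R) * 1 <= Num.sqrt s%:R * K by apply: ler_pM.
have B0 : 0 < B by rewrite /B -mulrA; lra.
have B1 : 1 < 2 * B by rewrite /B -mulrA; lra.
have [l [l0 lB Bl]] := dyadic_scale B1.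
have [Lam1 hM] := net_condition N2 s0 K1 hN l0 lB hL hm2.
have [lnN4 lnl] := ln_terms N2 e0 s0 K1 hs' he (dyadic_scale_log l0 lB).2 l0.
have lnN := @ln_ge_half R _ N2.
have e40 : 0 < eps / 4 by rewrite divr_gt0.
have N40 : 0 < 4 * N%:R :> R by rewrite mulr_gt0 // ltr0n.
have Y0 : 0 <= 4 * ln N%:R :> R by move: lnN; clear; lra.
have [q [delta [h1 h2 h3 h4]]] :=
  net_parameters e40 B0 l0 lB Bl N40 lnN4 lnl Y0 Lam1 hM.
have hxi' : (bos_distortion phi tau <=
    (D1 * Num.sqrt (m%:R ^+ 2 * ln m%:R / N%:R))%:E)%E.
  by apply: le_trans hxi _; rewrite lee_fin ge_min lexx.
have hlik := bos_recovery_likely bos iid m0 N0 K0 s0 h1 h2 h3 hxi'.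
have L0 : 0 <= L by apply: le_trans L2; rewrite invr_ge0.
have hm3 : m%:R <= 2 * (oversampling * s%:R * L) by move: hm1 dsL; clear; lra.
have sN : (s <= N)%N.
  rewrite -(ler_nat R); have NR1 : 1 <= N%:R :> R by rewrite ler1n.
  have qN : Num.sqrt N%:R <= N%:R :> R.
    have q1 : 1 <= Num.sqrt N%:R :> R by rewrite -[leLHS]sqrtr1 ler_wsqrtr.
    by rewrite -[leRHS]sqr_sqrtr ?ler0n // expr2 ler_peMl // (le_trans ler01).
  have sK : s%:R <= s%:R * K ^+ 2 :> R by rewrite ler_peMr // ltW.
  rewrite -mulrA in hs'.
  by move: sK qN hs' (ler0n R s); clear; lra.
have hE : (Num.sqrt N%:R / Num.sqrt s%:R + 1) / Num.sqrt (N%:R / (2 * m%:R)) <=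
    4 * Num.sqrt oversampling * Num.sqrt L.
  exact: quotient_constant s0 m0 sN (ltW d0) L0 hm3.
have [G [mG PG hG]] : likely P eps (fun w =>
    forall (x xhat : 'cV[R[i]]_N) (n : 'cV[R[i]]_m) (eta : R), 0 <= eta ->
    qcbp_minimizer (sampling_matrix phi (fun k => tau k w))
      (sampling_matrix phi (fun k => tau k w) *m x + n) eta xhat ->
    l2norm (xhat - x) <=
      1 / Num.sqrt s%:R * best_approx_l1 s x + 32 * eta +
      4 * Num.sqrt oversampling * Num.sqrt L * Num.max (l2norm n - eta) 0).
  apply: likely_mono hlik => [|w hw x xhat n eta eta0 hmin].
    by move: h4 hxi4 hmN e0; clear; lra.
  apply: (le_trans (hw x xhat n eta eta0 hmin)).
  rewrite mul1r [X in X + _ + _]mulrC lerD2l ler_wpM2r //.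
  by rewrite le_max lexx orbT.
exists G; split => // w Gw A x n eta eta0 y xhat hmin.
exact: (hG w Gw x xhat n eta eta0 hmin).
Qed.
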